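(* Let $S$ be a multiplicative subsemigroup of $\mathbb{N}$ containing $1$, and let $q_1<q_2<q_3<\cdots$ be an (infinite) sequence in $S$ such that for all $n\in S$, $$n=\prod_{k=1}^\infty q_k^{\alpha_k(n)}$$ for a unique compactly supported sequence $(\alpha_k(n))_{k\in\mathbb{N}}$ of nonnegative integers. Then the Bass stable rank of $\mathscr{H}^\infty_S$ is infinite.
   Context: $\mathbb{N}=\{1,2,3,\dots\}$ and $\mathbb{C}_0=\{s\in\mathbb{C}:\operatorname{Re}(s)>0\}$. $\mathscr{H}^\infty$ is the set of all Dirichlet series $f=\sum_{n=1}^\infty a_n n^{-s}$ ($a_n\in\mathbb{C}$ for all $n\in\mathbb{N}$) that converge at each $s\in\mathbb{C}_0$ and satisfy $\|f\|_\infty:=\sup_{s\in\mathbb{C}_0}|f(s)|<\infty$; it is a Banach algebra with pointwise operations and the norm $\|\cdot\|_\infty$. For $S\subset\mathbb{N}$, $\mathscr{H}^\infty_S$ is the set of all $f=\sum_{n=1}^\infty a_n n^{-s}\in\mathscr{H}^\infty$ such that $a_n=0$ for all $n\in\mathbb{N}\setminus S$; when $S$ is a multiplicative subsemigroup of $\mathbb{N}$ (i.e., $s_1s_2\in S$ for all $s_1,s_2\in S$) containing $1$, it is a unital commutative ring under pointwise operations. A sequence is compactly supported if all but finitely many of its terms are zero. Bass stable rank: let $A$ be a unital commutative ring with unit $1$. An element $(a_1,\dots,a_n)\in A^n$ is unimodular if there exist $b_1,\dots,b_n\in A$ with $b_1a_1+\cdots+b_na_n=1$; the set of unimodular elements of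 $A^n$ is denoted $U_n(A)$. An element $(a_1,\dots,a_{n+1})\in U_{n+1}(A)$ is reducible if there exist $x_1,\dots,x_n\in A$ such that $(a_1+x_1a_{n+1},\dots,a_n+x_na_{n+1})\in U_n(A)$. The Bass stable rank of $A$ is the least $n\in\mathbb{N}$ for which every element of $U_{n+1}(A)$ is reducible, and it is infinite if there is no such $n$. *)

(* Defs.v *)
From HB Require Import structures.
From mathcomp Require Import all_boot all_order all_algebra.
From mathcomp Require Import all_classical all_reals all_analysis.
From mathcomp Require Export complex.

Set Implicit Arguments.
Unset Strict Implicit.
Unset Printing Implicit Defensive.

Import Order.TTheory GRing.Theory Num.Theory numFieldNormedType.Exports.
Local Open Scope classical_set_scope.
Local Open Scope ring_scope.

(* A commutative ring is given here as a unital subring [A] of an ambient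
   commutative ring [T], with the operations inherited from [T]. *)
Section BassStableRank.
Context {T : comPzRingType}.
Implicit Type A : set T.

Definition unimodular A n (a : 'I_n -> T) : Prop :=
  (forall i, A (a i)) /\
  exists b : 'I_n -> T, (forall i, A (b i)) /\ \sum_(i < n) b i * a i = 1.

Definition reducible A n (a : 'I_n.+1 -> T) : Prop :=
  exists x : 'I_n -> T, (forall i, A (x i)) /\
    unimodular A (fun i : 'I_n => a (widen_ord (leqnSn n) i) + x i * a ord_max).

Definition stable_range A (n : nat) : Prop :=
  (0 < n)%N /\ forall a : 'I_n.+1 -> T, unimodular A a -> reducible A a.

Lemma ex_stable_range_asbool A :
  (exists n, stable_range A n) -> exists n, `[< stable_range A n >].
Proof. by move=> [n An]; exists n; apply/asboolP. Qed.

(* +oo encodes an infinite stable rank; -oo is never a value. *)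
Definition bass_stable_rank A : \bar nat :=
  match pselect (exists n, stable_range A n) with
  | left An => (ex_minn (ex_stable_range_asbool An))%:E
  | right _ => +oo%E
  end.

End BassStableRank.

Section DirichletSeries.
Context {R : realType}.

Definition right_half_plane := {s : R[i] | 0 < complex.Re s}.

Definition cexp (z : R[i]) : R[i] :=
  Complex (expR (complex.Re z) * cos (complex.Im z))
          (expR (complex.Re z) * sin (complex.Im z)).

(* n^{-s} = exp (- s log n), for n > 0 *)
Definition npowN (n : nat) (s : R[i]) : R[i] :=
  cexp (- s * real_complex R (ln n%:R)).

(* The coefficients are indexed by the positive integers: a 0 is ignored. *)
Definition dirichlet_partial_sum (a : nat -> R[i]) (s : R[i]) (N : nat)
    : R[i] :=
  \sum_(1 <= n < N.+1) a n * npowN n s.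

Definition has_dirichlet_series
    (f : right_half_plane -> R[i]) (a : nat -> R[i]) : Prop :=
  (* [^o] selects the usual topology of R[i], induced by the modulus *)
  forall s : right_half_plane,
    dirichlet_partial_sum a (val s) N @[N --> \oo] --> (f s : R[i]^o).

Definition supnorm (f : right_half_plane -> R[i]) : \bar R :=
  ereal_sup (range (fun s => (Normc.normc (f s))%:E)).

Definition Hinf : set (right_half_plane -> R[i]) :=
  [set f | (exists a, has_dirichlet_series f a) /\ (supnorm f < +oo)%E].

Definition HinfS (S : set nat) : set (right_half_plane -> R[i]) :=
  [set f | Hinf f /\ exists2 a, has_dirichlet_series f a &
                       forall n, (0 < n)%N -> ~ S n -> a n = 0].

End DirichletSeries.

Arguments right_half_plane : clear implicits.
Arguments Hinf : clear implicits.
Arguments HinfS : clear implicits.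

Definition compactly_supported (alpha : nat -> nat) : Prop :=
  finite_set [set k | alpha k != 0%N].

(* Main.v *)
Require Import Defs.
From HB Require Import structures.
From mathcomp Require Import all_boot all_order all_algebra fingroup perm.
From mathcomp Require Import bigenough ring zify.
From mathcomp Require mpoly ssrcomplements boolp.

(** Let [z_i = q_i^{-s}], [w_i = q_{n+i}^{-s}] for [i < n], and
    [g = c - sum_i z_i w_i] with [c > 0] small. The tuple [(z_1, ..., z_n, g)] is
    unimodular. If it were reducible, then [sum_i b_i h_i = 1] with
    [h_i = z_i + x_i g]. Comparing Dirichlet coefficients (Bohr's
    correspondence), this is an identity between power series in the independent
    variables [z, w], which converge near [0] because the coefficients of
    a Dirichlet series converging at [s = 1] are [O(n)]. For [w] the conjugate of
    [z], [h] would be a nowhere vanishing map on the ball [|z|^2 <= c] that is the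
    identity on its boundary sphere [g = 0], against the no-retraction theorem.

    The latter is proved algebraically. Set
    [k_i = w_i + b_i (c - sum_j w_j h_j)]. Then [sum_i h_i k_i = c], so the
    Jacobian determinant of [F = (h, k)] vanishes, while [F] is congruent to the
    identity modulo [g]. The linear form "integral over the ball", which has an
    explicit expression on monomials, kills
    the partial derivatives of the multiples of [g], so it takes the same value
    on the Jacobian determinants of [F] and of the identity, and the latter is
    not [0]. The power series are truncated to polynomials, the error being
    controlled by weighted l^1 norms. *)

Set Implicit Arguments.
Unset Strict Implicit.
Unset Printing Implicit Defensive.

Import Order.TTheory GRing.Theory Num.Theory.

(** * Jacobian determinants under derivations *)

Section Jacobian.
Local Open Scope ring_scope.
Variables (A : comNzRingType) (V : zmodType) (m : nat).
Variables (D : 'I_m -> {additive A -> A}) (L : {additive A -> V}) (g : A).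
Hypothesis DM : forall j p q, D j (p * q) = D j p * q + p * D j q.
Hypothesis DC : forall i j p, D i (D j p) = D j (D i p).
Hypothesis L_exact : forall j p, L (D j (g * p)) = 0.

Definition jacobian (F : 'I_m -> A) : 'M[A]_m := \matrix_(i, j) D j (F i).

Lemma derivation1 j : D j 1 = 0.
Proof.
by apply: (addIr (D j 1)); rewrite add0r -{3}[1]mulr1 DM mulr1 mul1r.
Qed.

Lemma derivation_prod (I : finType) j (p : I -> A) :
  D j (\prod_i p i) = \sum_k D j (p k) * \prod_(i | i != k) p i.
Proof.
have gen (r : seq I) : uniq r ->
    D j (\prod_(i <- r) p i)
    = \sum_(k <- r) D j (p k) * \prod_(i <- r | i != k) p i.
  elim: r => [|x r IHr] /=; first by rewrite !big_nil derivation1.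
  case/andP=> xr ur; rewrite !big_cons DM IHr // eqxx /=; congr (_ * _ + _).
    rewrite big_seq_cond [RHS]big_seq_cond; apply: eq_bigl => i.
    by case: (boolP (i \in r)) => //= ir; apply/esym; apply: contraNneq xr => <-.
  rewrite mulr_sumr big_seq [RHS]big_seq; apply: eq_bigr => k kr.
  rewrite big_cons ifT; first by rewrite mulrCA.
  by apply: contraNneq xr => ->.
by apply: gen; rewrite index_enum_uniq.
Qed.

(* Leibniz' formula writes the determinant as a divergence: the terms with
   second derivatives cancel in pairs under [s |-> tperm l k * s]. *)
Lemma jacobian_boundary (G : 'I_m -> A) l Y :
  G l = g * Y -> L (\det (jacobian G)) = 0.
Proof.
move=> Gl.
(* The family [p s] leaves the factor [l] undifferentiated, and in [T s k] the derivative [D (s l)]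
   falls on the factor [k]. The terms with [k = l] make up the determinant; the others cancel. *)
pose p (s : 'S_m) (i : 'I_m) := if i == l then G l else D (s i) (G i).
pose T (s : 'S_m) (k : 'I_m) := D (s l) (p s k) * \prod_(i | i != k) p s i.
have Tl (s : 'S_m) : \prod_i (jacobian G) i (s i) = T s l.
  rewrite /T (bigD1 l) //= mxE /p eqxx; congr (_ * _).
  by apply: eq_bigr => i /negPf il; rewrite mxE il.
have Tk k : k != l -> \sum_(s : 'S_m) (-1) ^+ s * T s k = 0.
  move=> kl; pose h (s : 'S_m) := (tperm l k * s)%g.
  have hK : involutive h by move=> s; rewrite /h mulgA tperm2 mul1g.
  have Th s : T (h s) k = T s k.
    rewrite /T /h !permM tpermL /p (negPf kl) !permM tpermR DC; congr (_ * _).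
    apply: eq_bigr => i ik; case: eqVneq => // il.
    by rewrite permM tpermD // eq_sym.
  have odd_h s : odd_perm (h s) = ~~ odd_perm s.
    by rewrite odd_permM odd_tperm eq_sym kl.
  rewrite (bigID (@odd_perm _)) /= (reindex_inj (inv_inj hK)) /=.
  rewrite (eq_bigl (fun s => ~~ odd_perm s)); last by move=> s; exact: odd_h.
  rewrite -big_split big1 //= => s es.
  by rewrite odd_h Th (negPf es) /= expr1 expr0 mulN1r mul1r addNr.
have -> : \det (jacobian G)
    = \sum_(s : 'S_m) (-1) ^+ s * D (s l) (\prod_i p s i).
  transitivity (\sum_k \sum_(s : 'S_m) (-1) ^+ s * T s k).
    rewrite (bigD1 l) //= [X in _ + X]big1 ?addr0; last by move=> k; exact: Tk.
    by apply: eq_bigr => s _; rewrite Tl.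
  rewrite exchange_big; apply: eq_bigr => s _ /=.
  by rewrite derivation_prod mulr_sumr.
rewrite raddf_sum big1 //= => s _.
rewrite (bigD1 l) //= {1}/p eqxx Gl -mulrA.
by case: odd_perm; rewrite ?expr1 ?mulN1r ?expr0 ?mul1r ?raddfN L_exact ?oppr0.
Qed.

(** The coordinates [y i] are replaced by [F i] one at a time. By linearity in row [l], each
    replacement adds the Jacobian determinant of a family whose entry [l] is [g * X l], which
    [jacobian_boundary] kills. *)
Lemma jacobian_invariance (y F X : 'I_m -> A) :
    (forall i j, D j (y i) = (i == j)%:R) ->
    (forall i, F i = y i + g * X i) ->
  L (\det (jacobian F)) = L 1.
Proof.
move=> Dy FE; pose Fk (k : nat) (i : 'I_m) := if (i < k)%N then F i else y i.
have step (k : nat) : (k <= m)%N -> L (\det (jacobian (Fk k))) = L 1.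
  elim: k => [_|k IHk km].
    rewrite -[1](det1 A m); congr (L (\det _)).
    by apply/matrixP => i j; rewrite !mxE Dy.
  rewrite -IHk 1?ltnW //; pose l := Ordinal km.
  pose G i := if i == l then g * X l else Fk k i.
  have nl i : (lift l i < k.+1)%N = (lift l i < k)%N.
    by rewrite ltnS leq_eqVlt -{1}[k]/(val l) val_eqE eq_sym (negPf (neq_lift _ _)).
  rewrite (@determinant_multilinear _ _ _ (jacobian (Fk k)) (jacobian G) l 1 1).
  - by rewrite !mul1r raddfD /= (@jacobian_boundary G l (X l)) ?addr0 // /G eqxx.
  - apply/rowP => j; rewrite !mxE !mul1r -raddfD /= /Fk /G /= ltnn ltnSn eqxx.
    by rewrite FE.
  - by apply/matrixP => i j; rewrite !mxE /Fk nl.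
  - apply/matrixP => i j; rewrite !mxE /G eq_sym (negPf (neq_lift _ _)).
    by rewrite /Fk nl.
rewrite -(step m) //; congr (L (\det _)); apply/matrixP => i j.
by rewrite !mxE /Fk ltn_ord.
Qed.

End Jacobian.

(** * Weighted l^1 norms of polynomials *)

Section MpolyNorm.
Local Open Scope ring_scope.
Import mpoly ssrcomplements BigEnough.
Variables (K : numFieldType) (m : nat).
Implicit Types (p q : {mpoly K[m]}) (a b : 'X_{1..m}) (r : K).

(** Puts sums over the supports of different polynomials on one common index set, so that they can
    be compared term by term. *)
Lemma big_msuppE (V : nmodType) (h : 'X_{1..m} -> K -> V) p k :
    (forall a, h a 0 = 0) -> (msize p <= k)%N ->
  \sum_(a <- msupp p) h a p@_a = \sum_(a : 'X_{1..m < k}) h a p@_a.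
Proof.
move=> h0 pk; set I : subFinType _ := 'X_{1..m < k}.
rewrite (big_mksub I) ?msupp_uniq //=; first last.
  by move=> x /msize_mdeg_lt /leq_trans; apply.
by rewrite big_rmcond //= => j /memN_msupp_eq0 ->.
Qed.

Definition mnorm r p : K := \sum_(a <- msupp p) `|p@_a| * r ^+ mdeg a.

Lemma mnormwE r p k : (msize p <= k)%N ->
  mnorm r p = \sum_(a : 'X_{1..m < k}) `|p@_a| * r ^+ mdeg a.
Proof.
apply: (big_msuppE (h := fun a x => `|x| * r ^+ mdeg a)) => a.
by rewrite normr0 mul0r.
Qed.

Lemma mnorm_ge0 r p : 0 <= r -> 0 <= mnorm r p.
Proof.
by move=> r0; apply: sumr_ge0 => a _; rewrite mulr_ge0 ?exprn_ge0.
Qed.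

Lemma mnorm0 r : mnorm r 0 = 0.
Proof. by rewrite /mnorm -mpolyC0 msupp0 big_nil. Qed.

Lemma mnormD r p q : 0 <= r -> mnorm r (p + q) <= mnorm r p + mnorm r q.
Proof.
move=> r0; pose_big_enough k; first rewrite !(@mnormwE r _ k) //.
  rewrite -big_split /=; apply: ler_sum => a _.
  by rewrite mcoeffD -mulrDl ler_wpM2r ?exprn_ge0 // ler_normD.
by close.
Qed.

Lemma mnorm_sum r (I : Type) (s : seq I) (P : pred I) (F : I -> {mpoly K[m]}) :
  0 <= r -> mnorm r (\sum_(i <- s | P i) F i) <= \sum_(i <- s | P i) mnorm r (F i).
Proof.
move=> r0; elim/big_rec2: _ => [|i x p _ ih]; first by rewrite mnorm0.
by apply: le_trans (mnormD _ _ r0) _; rewrite lerD2l.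
Qed.

Lemma mnormZX r (c : K) a : mnorm r (c *: 'X_[a]) = `|c| * r ^+ mdeg a.
Proof.
have [->|c0] := eqVneq c 0; first by rewrite scale0r mnorm0 normr0 mul0r.
by rewrite /mnorm msuppMCX // big_seq1 mcoeffZ mcoeffX eqxx mulr1.
Qed.

Lemma mnormM r p q : 0 <= r -> mnorm r (p * q) <= mnorm r p * mnorm r q.
Proof.
move=> r0; rewrite mpolyME; apply: le_trans (mnorm_sum _ _ _ r0) _.
rewrite big_allpairs /mnorm mulr_suml; apply: ler_sum => a _.
rewrite mulr_sumr; apply: ler_sum => b _.
by rewrite -/(mnorm _ _) /= mnormZX mdegD exprD normrM mulrACA.
Qed.

Lemma mnormN r p : mnorm r (- p) = mnorm r p.
Proof.
pose_big_enough k; first rewrite !(@mnormwE r _ k) //.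
  by apply: eq_bigr => a _; rewrite mcoeffN normrN.
by close.
Qed.

(** Differentiation brings down the exponent [a j <= 2 ^ mdeg a], which doubling the radius
    absorbs. *)
Lemma mnorm_deriv r p j : 0 < r -> mnorm r p^`M(j) <= r^-1 * mnorm (2 * r) p.
Proof.
move=> r0; have r0' := ltW r0.
rewrite /mderiv; apply: le_trans (mnorm_sum _ _ _ r0') _.
rewrite mulr_sumr; apply: ler_sum => a _; rewrite mnormZX.
have [->|aj] := posnP (a j).
  by rewrite mul0r normr0 mul0r !mulr_ge0 ?invr_ge0 ?exprn_ge0 // mulr_ge0.
have ja : (U_(j) <= a)%MM by rewrite lep1mP -lt0n.
have da : mdeg a = (mdeg (a - U_(j))).+1 by rewrite -{1}(submK ja) mdegD mdeg1 addn1.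
have aja : (a j <= mdeg a)%N by rewrite mdegE (bigD1 j) //= leq_addr.
have -> : r^-1 * (`|p@_a| * (2 * r) ^+ mdeg a)
    = `|p@_a| * (2 ^+ mdeg a * r ^+ mdeg (a - U_(j))%MM).
  rewrite exprMn mulrCA {2}da exprS; congr (_ * _).
  by rewrite [2 ^+ _ * (r * _)]mulrCA mulrA mulVf ?gt_eqF // mul1r.
rewrite normrM normr_nat [leLHS]mulrAC mulrC ler_wpM2l // ler_wpM2r ?exprn_ge0 //.
by rewrite -natrX ler_nat (leq_trans aja) // ltnW // ltn_expl.
Qed.

(** Doubling the radius multiplies the weight of a monomial of degree at least [d] by at least
    [2 ^ d]. *)
Lemma mnorm_tail r p (d : nat) : 0 <= r ->
    (forall a, (mdeg a < d)%N -> p@_a = 0) ->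
  2 ^+ d * mnorm r p <= mnorm (2 * r) p.
Proof.
move=> r0 pd; rewrite mulr_sumr; apply: ler_sum => a _.
have [/pd ->|da] := ltnP (mdeg a) d; first by rewrite normr0 !(mul0r, mulr0).
rewrite exprMn mulrCA ler_wpM2l // ler_wpM2r ?exprn_ge0 //.
by rewrite ler_eXn2l // ltr1n.
Qed.

Variable lam : 'X_{1..m} -> K.

Definition mpair p : K := \sum_(a <- msupp p) p@_a * lam a.

Lemma mpair_is_linear : linear_for *%R mpair.
Proof.
have mpairE p k : (msize p <= k)%N ->
    mpair p = \sum_(a : 'X_{1..m < k}) p@_a * lam a.
  apply: (big_msuppE (h := fun a x => x * lam a)) => a.
  by rewrite mul0r.
move=> c p q; pose_big_enough k; first rewrite !(mpairE _ k) //.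
  rewrite mulr_sumr -big_split /=; apply: eq_bigr => a _.
  by rewrite mcoeffD mcoeffZ mulrDl mulrA.
by close.
Qed.

HB.instance Definition _ :=
  GRing.isLinear.Build K {mpoly K[m]} K *%R mpair mpair_is_linear.

Lemma mpairX a : mpair 'X_[a] = lam a.
Proof. by rewrite /mpair msuppX big_seq1 mcoeffX eqxx mul1r. Qed.

Lemma mpair_le r p : (forall a, `|lam a| <= r ^+ mdeg a) ->
  `|mpair p| <= mnorm r p.
Proof.
move=> lamr; apply: le_trans (ler_norm_sum _ _ _) _; apply: ler_sum => a _.
by rewrite normrM ler_wpM2l.
Qed.

End MpolyNorm.

(** * Integration over the complex ball *)

Section BallMoments.
Local Open Scope ring_scope.
Import mpoly.
Variables (K : numFieldType) (n : nat) (c : K).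
Implicit Types (a b : 'X_{1..n + n}).

Definition zi (i : 'I_n) : 'I_(n + n) := lshift n i.
Definition wi (i : 'I_n) : 'I_(n + n) := rshift n i.

(** Rotating the single coordinate [z_i] multiplies a monomial by a phase, so only monomials with
    equal exponents in [z_i] and its conjugate, for each [i], have a nonzero integral over the
    ball. *)
Definition balanced a := [forall i, a (zi i) == a (wi i)].
Definition zdeg a := (\sum_(i < n) a (zi i))%N.

(* Up to the factor pi^n, the integral of the monomial over the ball
   [|z|^2 <= c] of C^n, where [w i] stands for the conjugate of [z i]. *)
Definition ball_moment a : K :=
  if balanced a then c ^+ (zdeg a) * (\prod_(i < n) (a (zi i))`!)%:R / (zdeg a + n)`!%:R
  else 0.

Definition ball_eq : {mpoly K[n + n]} :=
  c%:MP - \sum_(i < n) 'X_(zi i) * 'X_(wi i).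

Lemma zi_inj : injective zi. Proof. exact: lshift_inj. Qed.
Lemma wi_inj : injective wi. Proof. exact: rshift_inj. Qed.
Lemma ziwi i j : (zi i == wi j) = false.
Proof. exact: eq_lrshift. Qed.

Notation pairU i := (U_(zi i) + U_(wi i))%MM.

Lemma pairU_zi i k : (pairU i) (zi k) = (i == k) :> nat.
Proof. by rewrite mnmDE !mnm1E (inj_eq zi_inj) [wi _ == _]eq_sym ziwi addn0. Qed.

Lemma pairU_wi i k : (pairU i) (wi k) = (i == k) :> nat.
Proof. by rewrite mnmDE !mnm1E (inj_eq wi_inj) ziwi. Qed.

Lemma balanced_addU a i : balanced (pairU i + a)%MM = balanced a.
Proof.
by apply: eq_forallb => k; rewrite !(mnmDE _ (pairU i)) pairU_zi pairU_wi eqn_add2l.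
Qed.

(** This recursion, with the vanishing on unbalanced monomials, is all that the integration by parts
    below uses about the moments. *)
Lemma ball_moment_addU a i :
  ball_moment (pairU i + a)%MM
  = (a (zi i)).+1%:R * c / (zdeg a + n).+1%:R * ball_moment a.
Proof.
rewrite /ball_moment balanced_addU; case: ifP => _; last by rewrite mulr0.
have dE : zdeg (pairU i + a)%MM = (zdeg a).+1.
  rewrite /zdeg; under eq_bigr => k _ do rewrite mnmDE pairU_zi.
  rewrite big_split /= (bigD1 i) //= eqxx big1 ?addn0 ?add1n // => k ki.
  by rewrite eq_sym (negPf ki).
have fE : (\prod_(k < n) ((pairU i + a)%MM (zi k))`!
    = (a (zi i)).+1 * \prod_(k < n) (a (zi k))`!)%N.
  rewrite (bigD1 i) //= [in RHS](bigD1 i) //= mulnA; congr (_ * _)%N.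
    by rewrite mnmDE pairU_zi eqxx add1n factS.
  by apply: eq_bigr => k ki; rewrite mnmDE pairU_zi eq_sym (negPf ki).
rewrite dE fE addSn factS !natrM exprS invfM.
by rewrite -!mulrA; ring.
Qed.

(** An algebraic Stokes formula: [ball_eq * p] vanishes on the sphere, so its derivatives have
    integral 0 over the ball. On monomials it reduces to the recursion for the moments. *)
Lemma ball_moment_exact j p :
  mpair ball_moment (ball_eq * p)^`M(j) = 0.
Proof.
rewrite [p]mpolyE mulr_sumr (raddf_sum (mderiv j)) raddf_sum big1 //= => a _.
rewrite -scalerAr mderivZ linearZ /=.
suff -> : mpair ball_moment (ball_eq * 'X_[a])^`M(j) = 0 by rewrite mulr0.
(* The index [i0] is that of the conjugate pair containing the variable [j]; this treats both kinds
   of variable at once. *)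
have [i0 pairj bal_j] : exists2 i0, (forall i, (pairU i) j = (i == i0) :> nat)
    & forall b, balanced b -> b j = b (zi i0).
  case: (split_ordP j) => i0 ->; exists i0 => //.
  - by move=> i; apply: pairU_zi.
  - by move=> i; apply: pairU_wi.
  - by move=> b /forallP/(_ i0)/eqP.
have -> : mpair ball_moment (ball_eq * 'X_[a])^`M(j)
    = c * ((a j)%:R * ball_moment (a - U_(j))%MM)
      - \sum_(i < n) ((pairU i + a)%MM j)%:R * ball_moment (pairU i + a - U_(j))%MM.
  rewrite /ball_eq mulrBl mul_mpolyC mulr_suml mderivB mderivZ mderivX.
  rewrite raddfB /= !linearZ /= mpairX; congr (_ - _).
  rewrite (raddf_sum (mderiv j)) raddf_sum; apply: eq_bigr => i _ /=.
  by rewrite -!mpolyXD mderivX linearZ /= mpairX.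
have [/andP[aj bal]|] := boolP ((0 < a j)%N && balanced (a - U_(j))%MM); last first.
  move=> nb; have z b : ~~ balanced b -> ball_moment b = 0.
    by rewrite /ball_moment => /negPf ->.
  have -> : (a j)%:R * ball_moment (a - U_(j))%MM = 0.
    by move: nb; rewrite negb_and -eqn0Ngt => /orP[/eqP->|/z->]; rewrite ?mul0r ?mulr0.
  rewrite mulr0 sub0r big1 ?oppr0 // => i _.
  have [->|dj] := eqVneq ((pairU i + a)%MM j) 0%N; first by rewrite mul0r.
  rewrite z ?mulr0 //; apply: contra nb => bal.
  have [aj|aj] := posnP (a j); last first.
    by rewrite /= -(balanced_addU _ i) addmBA // lep1mP -lt0n.
  (* Here [i = i0], and removing [X_j] leaves exponent 0 at [j] but a positive one at its conjugate,
     so the monomial is not balanced. *)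
  exfalso; move: dj; rewrite mnmDE aj addn0 pairj => /eqP.
  case: eqVneq => // ii0 _.
  have := forallP bal i0; move: (bal_j _ bal).
  rewrite !mnmBE !(mnmDE _ (pairU i)) pairj aj mnm1E eqxx ii0 eqxx /= subnn.
  rewrite pairU_zi pairU_wi eqxx !mnm1E.
  case: eqVneq => [->|_]; last by rewrite subn0.
  by rewrite ziwi subn0 => <-.
have ja : (U_(j) <= a)%MM by rewrite lep1mP -lt0n.
set b := (a - U_(j))%MM in bal *.
have aE : a = (b + U_(j))%MM by rewrite /b submK.
have ajE : a j = (b (zi i0)).+1 by rewrite aE mnmDE mnm1E eqxx addn1 bal_j.
under eq_bigr => i _.
  rewrite mnmDE pairj ajE -addmBA // -/b ball_moment_addU.
  over.
(* The sum over [i] produces exactly the factor [zdeg b + n + 1] that cancels the denominator of the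
   recursion. *)
have sumE : (\sum_(i < n) ((i == i0) + (b (zi i0)).+1) * (b (zi i)).+1
    = (b (zi i0)).+1 * (zdeg b + n).+1)%N.
  under eq_bigr => i _ do rewrite mulnDl.
  rewrite big_split /= (bigD1 i0) //= eqxx mul1n big1 => [|i /negPf->] //.
  rewrite addn0 -big_distrr /= mulnS; congr (_ + _ * _)%N.
  under eq_bigr => i _ do rewrite -addn1.
  by rewrite big_split /= sum1_card card_ord.
under eq_bigr => i _.
  rewrite (_ : _ * _ = (((i == i0) + (b (zi i0)).+1) * (b (zi i)).+1)%N%:R
    * (c / (zdeg b + n).+1%:R * ball_moment b)); last by rewrite natrM; ring.
  over.
rewrite -mulr_suml -natr_sum sumE natrM ajE.
by field; rewrite -natrD nat1r pnatr_eq0.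
Qed.

(** A product of factorials is at most the factorial of the sum, and a balanced monomial has degree
    [2 * zdeg a]. With [mpair_le], integration over the ball is thus bounded by [mnorm r]. *)
Lemma ball_moment_le r a : 0 <= r -> c = r ^+ 2 -> `|ball_moment a| <= r ^+ mdeg a.
Proof.
move=> r0 cE; rewrite /ball_moment; case: ifP => [/forallP bal|_]; last first.
  by rewrite normr0 exprn_ge0.
have fact_le k l : (k`! * l`! <= (k + l)`!)%N.
  by rewrite -(bin_fact (leq_addr l k)) addKn leq_pmull // bin_gt0 leq_addr.
have -> : mdeg a = (2 * zdeg a)%N.
  rewrite mdegE big_split_ord /= mul2n -addnn; congr (_ + _)%N.
  by apply: eq_bigr => i _; have /eqP-> := bal i.
have c0 : 0 <= c by rewrite cE exprn_ge0.
rewrite exprM -cE ger0_norm ?mulr_ge0 ?exprn_ge0 ?invr_ge0 //.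
rewrite -mulrA ler_piMr ?exprn_ge0 // ler_pdivrMr ?ltr0n ?fact_gt0 // mul1r.
rewrite ler_nat /zdeg; apply: (@leq_trans (\sum_(i < n) a (zi i))`!).
  elim/big_rec2: _ => [|i x y _ ih] //; apply: leq_trans (fact_le _ _).
  by rewrite leq_mul2l ih orbT.
by rewrite leq_fact ?leq_addr.
Qed.

Lemma ball_moment0 : ball_moment 0%MM = n`!%:R^-1.
Proof.
rewrite /ball_moment ifT; last by apply/forallP => i; rewrite !mnm0E.
have -> : zdeg 0%MM = 0%N by rewrite /zdeg big1 // => i _; rewrite mnm0E.
by rewrite big1 ?mul1r // => i _; rewrite mnm0E.
Qed.

End BallMoments.

(** * Algebraic no-retraction theorem for the ball *)

Section NoRetraction.
Local Open Scope ring_scope.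
Import mpoly.
Variables (K : numFieldType).

Section Order.
Variable m : nat.
Implicit Types (p q : {mpoly K[m]}).

Definition vanishes_below (d : nat) p :=
  forall a : 'X_{1..m}, (mdeg a < d)%N -> p@_a = 0.

Lemma vanishes_belowD d p q :
  vanishes_below d p -> vanishes_below d q -> vanishes_below d (p + q).
Proof. by move=> hp hq a ad; rewrite mcoeffD hp // hq // addr0. Qed.

Lemma vanishes_belowN d p : vanishes_below d p -> vanishes_below d (- p).
Proof. by move=> hp a ad; rewrite mcoeffN hp // oppr0. Qed.

Lemma vanishes_belowM d p q : vanishes_below d p -> vanishes_below d (p * q).
Proof.
move=> hp a ad; rewrite mcoeffM big1 // => -[k l] /= /eqP aE.
rewrite hp ?mul0r // (leq_ltn_trans _ ad) // [leqRHS](congr1 (@mdeg _) aE).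
by rewrite mdegD leq_addr.
Qed.

Lemma vanishes_below_sum d (I : Type) (s : seq I) (P : pred I)
    (F : I -> {mpoly K[m]}) :
    (forall i, P i -> vanishes_below d (F i)) ->
  vanishes_below d (\sum_(i <- s | P i) F i).
Proof.
move=> hF; elim/big_rec: _ => [|i p Pi]; first by move=> a _; rewrite mcoeff0.
by apply: vanishes_belowD; apply: hF.
Qed.

Lemma vanishes_below_deriv d p j :
  vanishes_below d.+1 p -> vanishes_below d p^`M(j).
Proof.
by move=> hp a ad; rewrite mcoeff_deriv hp ?mul0rn // mdegD mdeg1 addn1.
Qed.

(** The index is a truncation degree: a bound uniform in it stands in for absolute convergence of a
    power series at radius [r]. *)
Definition norm_bounded (r : K) (P : nat -> {mpoly K[m]}) :=
  exists M, forall d, mnorm r (P d) <= M.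

Variable r : K.
Hypothesis r0 : 0 < r.

Lemma norm_bounded_cst p : norm_bounded r (fun=> p).
Proof. by exists (mnorm r p). Qed.

Lemma norm_boundedD P Q : norm_bounded r P -> norm_bounded r Q ->
  norm_bounded r (fun d => P d + Q d).
Proof.
move=> [M hM] [N hN]; exists (M + N) => d.
by apply: le_trans (mnormD _ _ (ltW r0)) _; apply: lerD.
Qed.

Lemma norm_boundedN P : norm_bounded r P -> norm_bounded r (fun d => - P d).
Proof. by move=> [M hM]; exists M => d; rewrite mnormN. Qed.

Lemma norm_boundedM P Q : norm_bounded r P -> norm_bounded r Q ->
  norm_bounded r (fun d => P d * Q d).
Proof.
move=> [M hM] [N hN]; exists (M * N) => d.
apply: le_trans (mnormM _ _ (ltW r0)) _.
by apply: ler_pM => //; apply: mnorm_ge0; apply: ltW.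
Qed.

Lemma norm_bounded_sum (I : Type) (s : seq I) (F : I -> nat -> {mpoly K[m]}) :
    (forall i, norm_bounded r (F i)) ->
  norm_bounded r (fun d => \sum_(i <- s) F i d).
Proof.
move=> hF; elim: s => [|i s ih].
  by exists 0 => d; rewrite big_nil mnorm0.
have [N hN] := norm_boundedD (hF i) ih.
by exists N => d; rewrite big_cons.
Qed.

Lemma norm_bounded_prod (I : Type) (s : seq I) (F : I -> nat -> {mpoly K[m]}) :
    (forall i, norm_bounded r (F i)) ->
  norm_bounded r (fun d => \prod_(i <- s) F i d).
Proof.
move=> hF; elim: s => [|i s ih].
  by exists (mnorm r (1 : {mpoly K[m]})) => d; rewrite big_nil.
have [N hN] := norm_boundedM (hF i) ih.
by exists N => d; rewrite big_cons.
Qed.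

Lemma norm_bounded_det k (J : nat -> 'M[{mpoly K[m]}]_k) :
    (forall i j, norm_bounded r (fun d => J d i j)) ->
  norm_bounded r (fun d => \det (J d)).
Proof.
move=> hJ; apply: norm_bounded_sum => s; apply: norm_boundedM.
  exact: norm_bounded_cst.
by apply: norm_bounded_prod => i; apply: hJ.
Qed.

Lemma norm_bounded_deriv P j : norm_bounded (2 * r) P ->
  norm_bounded r (fun d => (P d)^`M(j)).
Proof.
move=> [M hM]; exists (r^-1 * M) => d.
by apply: le_trans (mnorm_deriv _ _ r0) _; apply: ler_wpM2l => //; rewrite invr_ge0 ltW.
Qed.

End Order.

Variables (n : nat) (r : K).
Hypothesis r0 : 0 < r.
Let g := ball_eq n (r ^+ 2).
Variables (X B : nat -> 'I_n -> {mpoly K[n + n]}).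
Hypothesis Xbd : forall i, norm_bounded (2 * (2 * r)) (X^~ i).
Hypothesis Bbd : forall i, norm_bounded (2 * (2 * r)) (B^~ i).
Hypothesis XB : forall d, vanishes_below d.+1
  (\sum_(i < n) B d i * ('X_(zi i) + X d i * g) - 1).

(* If [sum_i b_i h_i = 1] and [h = z] on the sphere [g = 0], then
   [k = w + b (r^2 - <w, h>)] satisfies [k = w] on that sphere and
   [<h, k> = r^2] everywhere, so [(h, k)] has Jacobian determinant [0], whereas
   its integral over the ball is the volume of the ball. Below the identity
   [sum_i b_i h_i = 1] only holds up to terms of order [> d]. *)
Lemma ball_no_retraction :
  exists M, forall d : nat, 2 ^+ d * n`!%:R^-1 <= M :> K.
Proof.
pose c : {mpoly K[n + n]} := (r ^+ 2)%:MP.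
pose z i : {mpoly K[n + n]} := 'X_(zi i).
pose w i : {mpoly K[n + n]} := 'X_(wi i).
pose H d i := z i + X d i * g.
pose s d := c - \sum_i w i * H d i.
pose k d i := w i + B d i * s d.
pose e d := \sum_i B d i * H d i - 1.
have gE : g = c - \sum_i z i * w i by [].
have sE d : s d = g * (1 - \sum_i w i * X d i).
  rewrite mulrBr mulr1 mulr_sumr /s gE -addrA -opprD -big_split /=.
  congr (_ - _); apply: eq_bigr => i _.
  by rewrite -gE /H /z /w; ring.
(* The truncation error [e d] of the identity [sum b h = 1] is the only obstacle to [sum h k] being
   constant. *)
have HK d : \sum_i H d i * k d i = c + e d * s d.
  under eq_bigr => i _ do rewrite /k mulrDr mulrCA mulrA [H d i * w i]mulrC.
  rewrite big_split /= -mulr_suml /e mulrBl mul1r {3}/s.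
  by ring.
pose F d : 'rV_(n + n) := row_mx (\row_i H d i) (\row_i k d i).
(* The blocks are swapped because differentiating [sum h k] gives [sum (k dh + h dk)]: up to the
   error, the row [Fv] lies in the left kernel of the Jacobian matrix. *)
pose Fv d : 'rV_(n + n) := row_mx (\row_i k d i) (\row_i H d i).
pose J d := jacobian (@mderiv (n + n) K) (fun i => F d 0 i).
have Fz d i : F d 0 (zi i) = H d i by rewrite row_mxEl mxE.
have Fw d i : F d 0 (wi i) = k d i by rewrite row_mxEr mxE.
have Fvz d i : Fv d 0 (zi i) = k d i by rewrite row_mxEl mxE.
have Fvw d i : Fv d 0 (wi i) = H d i by rewrite row_mxEr mxE.
have JE d i j : J d i j = (F d 0 i)^`M(j) by rewrite mxE.
have small d : vanishes_below d (\det (J d)).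
  have psi_small : vanishes_below d.+1 (e d * s d) by apply: vanishes_belowM.
  have rel : Fv d *m J d = \row_j (e d * s d)^`M(j).
    apply/rowP => j; rewrite mxE [RHS]mxE big_split_ord /=.
    under eq_bigr => i _ do rewrite Fvz JE Fz.
    under [X in _ + X]eq_bigr => i _ do rewrite Fvw JE Fw.
    rewrite -big_split /=.
    have -> : e d * s d = \sum_i H d i * k d i - c by rewrite HK addrC addKr.
    rewrite mderivB mderivC subr0 (raddf_sum (mderiv j)); apply: eq_bigr => i _.
    by rewrite /= mderivM; ring.
  (* Multiplying the relation by the adjugate shows that each [det J * k_i] is small. Pairing with
     [h] then makes [det J * c] small, and [c] is a nonzero constant. *)
  have detv i : \det (J d) * k d i
      = \sum_j (e d * s d)^`M(j) * \adj (J d) j (zi i).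
    have := congr1 (fun u => (u *m \adj (J d)) 0 (zi i)) rel.
    rewrite -mulmxA mul_mx_adj mul_mx_scalar mxE Fvz [RHS]mxE => ->.
    by apply: eq_bigr => j _; rewrite mxE.
  have : vanishes_below d (\det (J d) * c).
    have -> : \det (J d) * c = \sum_i H d i * (\det (J d) * k d i)
        - e d * s d * \det (J d).
      under eq_bigr => i _ do rewrite mulrCA.
      by rewrite -mulr_sumr HK; ring.
    apply: vanishes_belowD; last first.
      apply: vanishes_belowN; apply: vanishes_belowM => a ad.
      by apply: psi_small; apply: ltnW.
    apply: vanishes_below_sum => i _; rewrite mulrC; apply: vanishes_belowM.
    rewrite detv; apply: vanishes_below_sum => j _; apply: vanishes_belowM.
    exact: vanishes_below_deriv.
  move=> hc a ad; have := hc a ad; rewrite mulrC mcoeffCM => /eqP.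
  by rewrite mulf_eq0 expf_eq0 gt_eqF //= => /eqP.
have LJ d : mpair (ball_moment (r ^+ 2)) (\det (J d)) = n`!%:R^-1.
  pose Y : 'I_(n + n) -> {mpoly K[n + n]} := fun j =>
    row_mx (\row_i X d i) (\row_i (B d i * (1 - \sum_i w i * X d i))) 0 j.
  rewrite (@jacobian_invariance _ _ _ (@mderiv (n + n) K) _ g _ _ _ (fun i => 'X_i) _ Y).
  - by rewrite -(ball_moment0 n (r ^+ 2)) -mpairX mpolyX0.
  - by move=> j p q; apply: mderivM.
  - by move=> i j p; apply: mderiv_comm.
  - by move=> j p; apply: ball_moment_exact.
  - move=> i j; rewrite /= mderivX mnm1E; case: eqVneq => [->|_].
      by rewrite -{1}[U_(j)%MM]add0m addmK mpolyX0 scale1r.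
    by rewrite scale0r.
  - move=> i; rewrite /Y; case: (split_ordP i) => l ->.
      by rewrite Fz row_mxEl mxE mulrC.
    by rewrite Fw row_mxEr mxE /k sE mulrCA.
(* Radius [4r] serves for [F], [2r] for its derivatives by [mnorm_deriv], and [r] for the final
   estimate by [mnorm_tail]. *)
have r2 : 0 < 2 * r by rewrite mulr_gt0.
have r4 : 0 < 2 * (2 * r) by rewrite mulr_gt0.
have Hbd i : norm_bounded (2 * (2 * r)) (H^~ i).
  by apply: norm_boundedD => //; [|apply: norm_boundedM => //]; apply: norm_bounded_cst.
have sbd : norm_bounded (2 * (2 * r)) s.
  apply: norm_boundedD => //; first exact: norm_bounded_cst.
  apply: norm_boundedN; apply: norm_bounded_sum => // i; apply: norm_boundedM => //.
  exact: norm_bounded_cst.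
have kbd i : norm_bounded (2 * (2 * r)) (k^~ i).
  by apply: norm_boundedD => //; [apply: norm_bounded_cst|apply: norm_boundedM].
have [M hM] : norm_bounded (2 * r) (fun d => \det (J d)).
  apply: norm_bounded_det => // i j.
  suff [N hN] : norm_bounded (2 * r) (fun d => (F d 0 i)^`M(j)).
    by exists N => d; rewrite JE.
  apply: norm_bounded_deriv => //; rewrite /F; case: (split_ordP i) => l ->.
    by have [N hN] := Hbd l; exists N => d; rewrite Fz.
  by have [N hN] := kbd l; exists N => d; rewrite Fw.
exists M => d; apply: le_trans (hM d).
apply: le_trans (mnorm_tail (ltW r0) (small d)).
rewrite ler_wpM2l ?exprn_ge0 // -(LJ d).
rewrite -[leLHS]ger0_norm ?LJ ?invr_ge0 // -(LJ d).
by apply: mpair_le => a; apply: ball_moment_le => //; apply: ltW.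
Qed.

End NoRetraction.

(** * Coefficients of Dirichlet series *)

Section DirichletCoefficients.
Local Open Scope ring_scope.
Variable K : numFieldType.
Hypothesis archK : forall x : K, 0 <= x -> exists k : nat, x <= k%:R.

Definition tends (u : nat -> K) (l : K) :=
  forall eps, 0 < eps -> exists N0, forall N, (N0 <= N)%N -> `|u N - l| <= eps.

Lemma tendsD u v l m :
  tends u l -> tends v m -> tends (fun N => u N + v N) (l + m).
Proof.
move=> hu hv e e0; have e2 : 0 < e / 2 by rewrite divr_gt0.
have [N1 h1] := hu _ e2; have [N2 h2] := hv _ e2.
exists (maxn N1 N2) => N; rewrite geq_max => /andP[/h1 {}h1 /h2 {}h2].
rewrite opprD addrACA (le_trans (ler_normD _ _)) // (splitr e).
exact: lerD.
Qed.

Lemma tendsM u v l m :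
  tends u l -> tends v m -> tends (fun N => u N * v N) (l * m).
Proof.
move=> hu hv e e0; set C := e + 1 + `|l| + `|m|.
have C0 : 0 < C by rewrite !ltr_wpDr.
have d0 : 0 < e / C by rewrite divr_gt0.
have d1 : e / C <= 1.
  by rewrite ler_pdivrMr // mul1r /C -!addrA lerDl !addr_ge0.
have [N1 h1] := hu _ d0; have [N2 h2] := hv _ d0.
exists (maxn N1 N2) => N; rewrite geq_max => /andP[/h1 {}h1 /h2 {}h2].
have -> : u N * v N - l * m
    = (u N - l) * (v N - m) + l * (v N - m) + (u N - l) * m by ring.
apply: (@le_trans _ _ (e / C * 1 + `|l| * (e / C) + e / C * `|m|)).
  rewrite (le_trans (ler_normD _ _)) // !normrM lerD //; last by rewrite ler_wpM2r.
  rewrite (le_trans (ler_normD _ _)) // !normrM lerD //; last by rewrite ler_wpM2l.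
  by rewrite ler_pM // (le_trans h2).
have -> : e / C * 1 + `|l| * (e / C) + e / C * `|m| = e / C * (1 + `|l| + `|m|) by ring.
rewrite -[leRHS](divfK (lt0r_neq0 C0)); apply: ler_wpM2l; first exact: ltW.
by rewrite /C -!addrA lerDr ltW.
Qed.

Lemma tends_cst l : tends (fun=> l) l.
Proof. by move=> e e0; exists 0%N => N _; rewrite subrr normr0 ltW. Qed.

Lemma tends_eventually u v l (N1 : nat) :
  tends u l -> (forall N, (N1 <= N)%N -> v N = u N) -> tends v l.
Proof.
move=> ul vu e e0; have [N0 h] := ul e e0; exists (maxn N0 N1) => N.
by rewrite geq_max => /andP[N0N N1N]; rewrite vu // h.
Qed.

Lemma tends_near0 u v l C :
  tends u l -> (forall N, `|v N - u N| <= C / N.+1%:R) -> tends v l.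
Proof.
move=> ul uv e e0; have e2 : 0 < e / 2 by rewrite divr_gt0.
have [N0 h0] := ul _ e2.
have C0 : 0 <= C by have := le_trans (normr_ge0 _) (uv 0%N); rewrite divr1.
have [k hk] := archK (divr_ge0 C0 (ltW e2)).
exists (maxn N0 k) => N; rewrite geq_max => /andP[/h0 {}h0 kN].
have -> : v N - l = (v N - u N) + (u N - l) by ring.
rewrite (le_trans (ler_normD _ _)) // (splitr e) lerD //.
rewrite (le_trans (uv N)) // ler_pdivrMr ?ltr0n // mulrC -ler_pdivrMr //.
by rewrite (le_trans hk) // ler_nat (leq_trans kN).
Qed.

Lemma tends_le u l C : tends u l -> (exists N1, forall N, (N1 <= N)%N -> `|u N| <= C) ->
  forall e, 0 < e -> `|l| <= C + e.
Proof.
move=> ul [N1 h1] e e0; have [N0 h0] := ul e e0.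
have := h1 (maxn N0 N1) (leq_maxr _ _); have := h0 (maxn N0 N1) (leq_maxl _ _).
move: (u _) => x hx hC; have -> : l = x - (x - l) by ring.
by rewrite (le_trans (ler_normB _ _)) // lerD.
Qed.

(* The term [k = 0] is [0] for [s > 0], as [0^-1 = 0]. *)
Definition dsum (a : nat -> K) (s N : nat) : K :=
  \sum_(0 <= k < N.+1) a k / k%:R ^+ s.

Definition conv_term (a b : nat -> K) (k d e : nat) : K :=
  if (d * e == k)%N then a d * b e else 0.

(** Dirichlet convolution, written over a box instead of the divisors of [k], so that [dconv_widen]
    can give all [k] up to [N] the same range of summation. *)
Definition dconv (a b : nat -> K) (k : nat) : K :=
  \sum_(0 <= d < k.+1) \sum_(0 <= e < k.+1) conv_term a b k d e.

(* The exponent [p.+1 > 0] forces [a 0 = 0]. *)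
Definition poly_growth (p : nat) (C : K) (a : nat -> K) :=
  forall k, `|a k| <= C * k%:R ^+ p.+1.

Lemma poly_growth0 p C a : poly_growth p C a -> a 0%N = 0.
Proof. by move=> /(_ 0%N); rewrite expr0n mulr0 normr_le0 => /eqP. Qed.

Lemma poly_growth_ge0 p C a : poly_growth p C a -> 0 <= C.
Proof. by move=> /(_ 1%N); rewrite expr1n mulr1; apply: le_trans. Qed.

Lemma poly_growth_weaken p p' C C' a : (p <= p')%N -> C <= C' ->
  poly_growth p C a -> poly_growth p' C' a.
Proof.
move=> pp CC ha k; have C0 := poly_growth_ge0 ha.
apply: le_trans (ha k) _; case: k => [|k]; first by rewrite !expr0n !mulr0.
by rewrite ler_pM ?exprn_ge0 // -!natrX ler_nat leq_pexp2l.
Qed.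

Lemma poly_growthD p C a p' C' a' : poly_growth p C a -> poly_growth p' C' a' ->
  poly_growth (maxn p p') (C + C') (fun k => a k + a' k).
Proof.
move=> ha ha' k; rewrite mulrDl (le_trans (ler_normD _ _)) // lerD //.
  by apply: (poly_growth_weaken _ _ ha); rewrite ?leq_maxl.
by apply: (poly_growth_weaken _ _ ha'); rewrite ?leq_maxr.
Qed.

Lemma dconv_widen a b k N : a 0%N = 0 -> b 0%N = 0 -> (k <= N)%N ->
  dconv a b k = \sum_(0 <= d < N.+1) \sum_(0 <= e < N.+1) conv_term a b k d e.
Proof.
move=> a0 b0 kN.
have ct d e : (k < maxn d e)%N -> conv_term a b k d e = 0.
  rewrite /conv_term leq_max; case: eqP => // <-.
  case: d => [|d]; first by rewrite a0 mul0r.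
  case: e => [|e]; first by rewrite b0 mulr0.
  by rewrite [(_ < d.+1)%N]ltnNge leq_pmulr //= [(_ < e.+1)%N]ltnNge leq_pmull.
have wid (G : nat -> K) : (forall d, (k < d)%N -> G d = 0) ->
    \sum_(0 <= d < N.+1) G d = \sum_(0 <= d < k.+1) G d.
  move=> G0; rewrite (big_cat_nat (n := k.+1)) //= [X in _ + X]big_nat_cond.
  by rewrite [X in _ + X]big1 ?addr0 // => d /andP[/andP[/G0]].
rewrite wid => [|d kd]; last by rewrite big1 // => e _; rewrite ct // leq_max kd.
by apply: eq_bigr => d _; rewrite wid // => e ke; rewrite ct // leq_max ke orbT.
Qed.

(** The crude count of [(k + 1) ^ 2 <= 4 * k ^ 2] pairs, for [k > 0], costs the factor 4 and two
    powers of [k]. *)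
Lemma poly_growth_conv p C a C' b : poly_growth p C a -> poly_growth p C' b ->
  poly_growth p.+2 (4 * C * C') (dconv a b).
Proof.
move=> ha hb k; have C0 := poly_growth_ge0 ha; have C0' := poly_growth_ge0 hb.
have CC0 : 0 <= C * C' by rewrite mulr_ge0.
case: k => [|k].
  rewrite /dconv !big_nat1 /conv_term eqxx (poly_growth0 ha) mul0r normr0.
  by rewrite mulr_ge0 ?exprn_ge0 // mulr_ge0 ?mulr_ge0.
apply: (@le_trans _ _ (\sum_(0 <= d < k.+2) \sum_(0 <= e < k.+2)
    (C * C' * k.+1%:R ^+ p.+1))).
  apply: le_trans (ler_norm_sum _ _ _) _; apply: ler_sum => d _.
  apply: le_trans (ler_norm_sum _ _ _) _; apply: ler_sum => e _.
  rewrite /conv_term; case: eqP => [<-|_]; last by rewrite normr0 mulr_ge0 ?exprn_ge0.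
  by rewrite normrM natrM exprMn mulrACA ler_pM.
rewrite !sumr_const_nat subn0 -mulrnA -[leLHS]mulr_natl.
have -> : 4 * C * C' * k.+1%:R ^+ p.+3 = (4 * k.+1 ^ 2)%:R * (C * C' * k.+1%:R ^+ p.+1).
  by rewrite natrM natrX !exprS; ring.
rewrite ler_wpM2r ?mulr_ge0 ?exprn_ge0 // ler_nat.
rewrite -[4%N]/(2 ^ 2)%N -expnMn mulnn leq_exp2r //.
by rewrite mul2n -addnn addSn ltnS leq_addl.
Qed.

(** Telescoping gives the sharper bound [2 - 1/N]; with [0^-1 = 0] it also covers [N = 0] and the
    term [k = 0]. *)
Lemma sum_inv_sqr (N : nat) : \sum_(0 <= k < N.+1) (k%:R ^+ 2)^-1 <= 2 :> K.
Proof.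
suff: \sum_(0 <= k < N.+1) (k%:R ^+ 2)^-1 <= 2 - N%:R^-1 :> K.
  by move=> h; rewrite (le_trans h) // gerBl invr_ge0.
elim: N => [|N ih]; first by rewrite big_nat1 expr0n invr0 subr0.
rewrite big_nat_recr //=.
case: N ih => [_|N ih].
  by rewrite big_nat1 expr0n invr0 add0r expr1n invr1 (_ : 2 - 1 = 1) //; ring.
apply: le_trans (lerD ih (lexx _)) _.
rewrite -addrA lerD2l -subr_ge0.
have -> : - N.+2%:R^-1 - (- N.+1%:R^-1 + (N.+2%:R ^+ 2)^-1)
    = (N.+2%:R ^+ 2 * N.+1%:R)^-1 :> K.
  have : 0 < N.+1%:R :> K by rewrite ltr0n.
  rewrite -[N.+2%:R]natr1; move: N.+1%:R => x x0; field.
  by rewrite !gt_eqF // ltr_wpDr.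
by rewrite invr_ge0 mulr_ge0 ?exprn_ge0.
Qed.

(** The product of partial sums runs over the square [d, e <= N], the partial sum of the convolution
    over its part [d * e <= N]. The remaining terms have [d * e >= N + 1] and are summably small. *)
Lemma dsum_conv_near p C a C' b s N :
    poly_growth p C a -> poly_growth p C' b -> (p + 4 <= s)%N ->
  `|dsum (dconv a b) s N - dsum a s N * dsum b s N| <= 4 * C * C' / N.+1%:R.
Proof.
move=> ha hb ps; have C0 := poly_growth_ge0 ha; have C0' := poly_growth_ge0 hb.
pose T d e := a d * b e / (d * e)%:R ^+ s.
have -> : dsum a s N * dsum b s N
    = \sum_(0 <= d < N.+1) \sum_(0 <= e < N.+1) T d e.
  rewrite /dsum big_distrlr /=; apply: eq_bigr => d _; apply: eq_bigr => e _.
  by rewrite /T natrM exprMn invfM; ring.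
have -> : dsum (dconv a b) s N = \sum_(0 <= d < N.+1) \sum_(0 <= e < N.+1)
    if (d * e < N.+1)%N then T d e else 0.
  rewrite /dsum big_nat; under eq_bigr => k /andP[_ kN].
    rewrite (dconv_widen (poly_growth0 ha) (poly_growth0 hb) (kN : (k <= N)%N)) mulr_suml.
    under eq_bigr do rewrite mulr_suml.
    over.
  rewrite -big_nat exchange_big /=; apply: eq_bigr => d _.
  rewrite exchange_big /=; apply: eq_bigr => e _.
  transitivity (\sum_(0 <= k < N.+1 | k == (d * e)%N) a d * b e / k%:R ^+ s);
    last by rewrite big_nat1_eq.
  rewrite [RHS]big_mkcond; apply: eq_bigr => k _.
  by rewrite /conv_term eq_sym; case: eqP; rewrite ?mul0r.
rewrite -sumrB; under eq_bigr do rewrite -sumrB.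
pose V (k : nat) : K := (k%:R ^+ 2)^-1.
apply: (@le_trans _ _ (\sum_(0 <= d < N.+1) \sum_(0 <= e < N.+1)
    (C * C' / N.+1%:R) * (V d * V e))).
  apply: le_trans (ler_norm_sum _ _ _) _; apply: ler_sum => d _.
  apply: le_trans (ler_norm_sum _ _ _) _; apply: ler_sum => e _.
  have V0 k : 0 <= V k by rewrite invr_ge0 exprn_ge0.
  case: ltnP => [_|de]; first by rewrite subrr normr0 !mulr_ge0 ?V0 ?invr_ge0.
  have de0 : 0 < (d * e)%:R :> K by rewrite ltr0n (leq_trans _ de).
  have -> : V d * V e = ((d * e)%:R ^+ 2)^-1 by rewrite natrM exprMn invfM.
  rewrite sub0r normrN /T normrM normfV normrX normr_nat ler_pdivrMr ?exprn_gt0 //.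
  apply: (@le_trans _ _ (C * C' * (d * e)%:R ^+ p.+1)).
    by rewrite normrM natrM exprMn mulrACA ler_pM.
  rewrite -!mulrA ler_wpM2l // ler_wpM2l //.
  (* Of the exponent [s], [p + 1] offsets the growth of the coefficients, 2 makes the double sum
     converge, 1 yields the factor [1 / (N + 1)], and [t] is left over. *)
  have [t ->] : exists t, s = (p.+1 + 2 + 1 + t)%N.
    by exists (s - (p + 4))%N; lia.
  rewrite !exprD expr1.
  have -> : N.+1%:R^-1 * (((d * e)%:R ^+ 2)^-1 * ((d * e)%:R ^+ p.+1 *
      (d * e)%:R ^+ 2 * (d * e)%:R * (d * e)%:R ^+ t))
    = (d * e)%:R ^+ p.+1 * (((d * e)%:R / N.+1%:R) * (d * e)%:R ^+ t) :> K.
    by move: de0; move: (d * e)%:R (N.+1%:R : K)^-1 => x y x0; field; rewrite gt_eqF.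
  apply: ler_peMr; first by rewrite exprn_ge0.
  apply: mulr_ege1; first by rewrite ler_pdivlMr ?ltr0n // mul1r ler_nat.
  by rewrite exprn_ege1 // (ler_nat _ 1); move: de0; rewrite ltr0n.
have -> : 4 * C * C' / N.+1%:R = C * C' / N.+1%:R * (2 * 2) by ring.
under eq_bigr do rewrite -mulr_sumr.
rewrite -mulr_sumr ler_wpM2l ?mulr_ge0 ?invr_ge0 //.
have VV0 : 0 <= \sum_(0 <= k < N.+1) V k.
  by apply: sumr_ge0 => k _; rewrite invr_ge0 exprn_ge0.
by under eq_bigr do rewrite -mulr_sumr; rewrite -mulr_suml ler_pM // sum_inv_sqr.
Qed.

Lemma tends_dsum_conv p C a C' b s l m :
    poly_growth p C a -> poly_growth p C' b -> (p + 4 <= s)%N ->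
    tends (dsum a s) l -> tends (dsum b s) m ->
  tends (dsum (dconv a b) s) (l * m).
Proof.
move=> ha hb ps hl hm; apply: tends_near0 (tendsM hl hm) _ => N.
exact: (dsum_conv_near _ ha hb ps).
Qed.

(** If [k] is the first index with [a k != 0], the terms after it are smaller than the [k]-th by a
    factor of order [(k / (k + 1)) ^ s]. Bernoulli's inequality turns this into a bound on
    [|a k| * (1 + t / k)] uniform in [t]. *)
Lemma dirichlet_unique p C a s0 :
    poly_growth p C a -> (forall s, (s0 <= s)%N -> tends (dsum a s) 0) ->
  forall k, a k = 0.
Proof.
move=> ha h0 k; have C0 := poly_growth_ge0 ha.
elim/ltn_ind: k => -[_|n ih]; first exact: poly_growth0 ha.
set k := n.+1 in ih *.
have k0 : 0 < k%:R :> K by rewrite ltr0n.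
have bernoulli (x : K) t : 0 <= x -> 1 + t%:R * x <= (1 + x) ^+ t.
  move=> x0; elim: t => [|t IHt]; first by rewrite mul0r addr0 expr0.
  rewrite exprS; apply: le_trans (ler_wpM2l _ IHt); last by rewrite addr_ge0.
  rewrite -natr1 -subr_ge0.
  have -> : (1 + x) * (1 + t%:R * x) - (1 + (t%:R + 1) * x) = t%:R * x ^+ 2 by ring.
  by rewrite mulr_ge0 ?exprn_ge0.
have key t : (s0 <= t)%N ->
    `|a k| * (1 + t%:R * k%:R^-1) <= (2 * C + 1) * k%:R ^+ p.+3.
  move=> s0t; pose s := (p.+1 + 2 + t)%N.
  have s0s : (s0 <= s)%N by rewrite (leq_trans s0t) // leq_addl.
  have k1t : 0 < k.+1%:R ^+ t :> K by rewrite exprn_gt0 ?ltr0n.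
  have lim := tendsD (h0 s s0s) (tends_cst (- (a k / k%:R ^+ s))).
  have tail : exists N1, forall N, (N1 <= N)%N ->
      `|dsum a s N - a k / k%:R ^+ s| <= 2 * C / k.+1%:R ^+ t.
    exists k => N kN.
    have -> : dsum a s N - a k / k%:R ^+ s
        = \sum_(0 <= j < N.+1) if (k < j)%N then a j / j%:R ^+ s else 0.
      rewrite /dsum (big_cat_nat (n := k)) ?leqW //= [X in X + _ - _]big_nat.
      rewrite [X in X + _ - _]big1 ?add0r => [|j jk]; last by rewrite ih ?mul0r.
      rewrite [in RHS](big_cat_nat (n := k)) ?leqW //= [X in _ = X + _]big_nat.
      rewrite [X in _ = X + _]big1 ?add0r => [|j jk]; last by rewrite ltnNge ltnW.
      rewrite big_ltn // addrAC subrr add0r [in RHS]big_ltn // ltnn add0r.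
      by rewrite big_nat [RHS]big_nat; apply: eq_bigr => j /andP[->].
    apply: (@le_trans _ _ (\sum_(0 <= j < N.+1) (C / k.+1%:R ^+ t * (j%:R ^+ 2)^-1))).
      apply: le_trans (ler_norm_sum _ _ _) _; apply: ler_sum => j _.
      case: ltnP => kj; last by rewrite normr0 !mulr_ge0 ?invr_ge0 ?exprn_ge0.
      have j0 : 0 < j%:R :> K by rewrite ltr0n (leq_trans _ kj).
      rewrite normrM normfV normrX normr_nat ler_pdivrMr ?exprn_gt0 //.
      apply: le_trans (ha j) _.
      have -> : C / k.+1%:R ^+ t * (j%:R ^+ 2)^-1 * j%:R ^+ s
          = C * j%:R ^+ p.+1 * (j%:R ^+ t / k.+1%:R ^+ t).
        by rewrite /s !exprD; move: (_ ^+ t)^-1 => y; field; rewrite gt_eqF.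
      rewrite ler_peMr ?mulr_ge0 ?exprn_ge0 // ler_pdivlMr // mul1r.
      by rewrite lerXn2r ?nnegrE // ler_nat.
    rewrite -mulr_sumr [leRHS](_ : _ = C / k.+1%:R ^+ t * 2); last by ring.
    by rewrite ler_wpM2l ?mulr_ge0 ?invr_ge0 ?exprn_ge0 // sum_inv_sqr.
  (* The slack is chosen of the same order as the tail bound, whence the constant [2 * C + 1]. *)
  have := tends_le lim tail (e := (k.+1%:R ^+ t)^-1).
  rewrite invr_gt0 => /(_ k1t).
  rewrite add0r normrN normrM normfV normrX normr_nat.
  rewrite -[X in _ + X]mul1r -mulrDl ler_pdivrMr ?exprn_gt0 //.
  rewrite mulrAC ler_pdivlMr // => h.
  have kt0 : 0 < k%:R ^+ t :> K by rewrite exprn_gt0.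
  rewrite -(ler_pM2r kt0); apply: (@le_trans _ _ (`|a k| * k.+1%:R ^+ t)).
    rewrite -mulrA ler_wpM2l // -ler_pdivlMr // -expr_div_n -[k.+1]addn1 natrD.
    rewrite mulrDl divff ?gt_eqF // mul1r; apply: bernoulli.
    by rewrite invr_ge0 ltW.
  apply: le_trans h _; rewrite -mulrA -exprD ler_wpM2l //.
    by rewrite addr_ge0 // mulr_ge0.
  by rewrite (_ : s = p.+3 + t)%N // /s addn2.
apply/eqP/contraT => ak; have ak0 : 0 < `|a k| by rewrite normr_gt0.
set E := (2 * C + 1) * k%:R ^+ p.+3 in key.
have E0 : 0 <= E by rewrite mulr_ge0 ?exprn_ge0 // addr_ge0 // mulr_ge0.
have [T hT] : exists T : nat, E * k%:R / `|a k| <= T%:R.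
  by apply: archK; rewrite divr_ge0 // mulr_ge0.
have := key _ (leq_maxl s0 T); rewrite mulrDr mulr1.
move=> /le_trans /(_ (_ : E <= `|a k| * ((maxn s0 T)%:R / k%:R))).
rewrite gerDr normr_le0 (negPf ak); apply.
rewrite mulrA ler_pdivlMr // -ler_pdivrMl // mulrC (le_trans hT) // ler_nat.
exact: leq_maxr.
Qed.

(** Past some index the partial sums are within 1 of the limit, so a term [a k / k], the difference
    of two of them, is at most 2. The finitely many earlier coefficients go into the constant. *)
Lemma poly_growth_dsum a l : a 0%N = 0 -> tends (dsum a 1) l ->
  exists C, poly_growth 0 C a.
Proof.
move=> a0 al; have [N0 h] := al 1 ltr01.
set C := \sum_(0 <= k < N0.+1) `|a k|; have C0 : 0 <= C by apply: sumr_ge0.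
exists (2 + C) => -[|k]; first by rewrite a0 normr0 expr1 mulr0.
rewrite expr1; have [kN|Nk] := ltnP k N0.
  apply: (@le_trans _ _ (2 + C)); last by rewrite ler_peMr ?ler1n // addr_ge0.
  rewrite /C (bigD1_seq k.+1) ?mem_index_iota ?iota_uniq //= addrCA lerDl.
  by rewrite addr_ge0 ?sumr_ge0.
rewrite mulrDl -[leLHS]addr0 lerD ?mulr_ge0 // -ler_pdivrMr ?ltr0n //.
have -> : `|a k.+1| / k.+1%:R = `|dsum a 1 k.+1 - l - (dsum a 1 k - l)|.
  rewrite opprB addrA subrK /dsum [X in X - _]big_nat_recr //= addrAC subrr add0r.
  by rewrite expr1 normrM normfV normr_nat.
by rewrite (le_trans (ler_normB _ _)) // lerD // h // leqW.
Qed.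

End DirichletCoefficients.

(** * The Bohr lift *)

Section BohrLift.
Local Open Scope ring_scope.
Import mpoly.
Variables (K : numFieldType) (m : nat) (q : 'I_m -> nat) (S : nat -> Prop).

(** Bohr's correspondence: the variable [X_i] stands for [q_i^{-s}], hence the monomial of exponent
    [al] for [(qpow al)^{-s}]. *)
Definition qpow (al : 'X_{1..m}) : nat := (\prod_i q i ^ al i)%N.

Hypothesis qpow_inj : injective qpow.
Hypothesis qpow_gt0 : forall al, (0 < qpow al)%N.
Hypothesis qpow_dvd : forall d e al, S d -> S e -> (d * e)%N = qpow al ->
  exists be ga, d = qpow be /\ e = qpow ga.

Lemma qpowD al be : qpow (al + be)%MM = (qpow al * qpow be)%N.
Proof.
by rewrite /qpow -big_split; apply: eq_bigr => i _; rewrite mnmDE expnD.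
Qed.

Lemma qpow0 : qpow 0%MM = 1%N.
Proof. by rewrite /qpow big1 // => i _; rewrite mnm0E. Qed.

Lemma qpowU i : qpow U_(i)%MM = q i.
Proof.
rewrite /qpow (bigD1 i) //= mnm1E eqxx expn1 big1 ?muln1 // => j ji.
by rewrite mnm1E eq_sym (negPf ji).
Qed.

Definition supported (a : nat -> K) := forall k, ~ S k -> a k = 0.

(** Coefficients of degree above [d] are left free, so that the relation survives products of
    truncations. *)
Definition agree (d : nat) (p : {mpoly K[m]}) (a : nat -> K) :=
  forall al : 'X_{1..m}, (mdeg al <= d)%N -> p@_al = a (qpow al).

Lemma agreeD d p a p' a' : agree d p a -> agree d p' a' ->
  agree d (p + p') (fun k => a k + a' k).
Proof. by move=> h h' al ald; rewrite mcoeffD h // h'. Qed.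

Lemma agreeZ d p a c : agree d p a -> agree d (c *: p) (fun k => c * a k).
Proof. by move=> h al ald; rewrite mcoeffZ h. Qed.

Lemma agree_sum d (I : Type) (s : seq I) (p : I -> {mpoly K[m]}) a :
    (forall i, agree d (p i) (a i)) ->
  agree d (\sum_(i <- s) p i) (fun k => \sum_(i <- s) a i k).
Proof.
by move=> h al ald; rewrite raddf_sum; apply: eq_bigr => i _; apply: h.
Qed.

Lemma agreeX d be : agree d 'X_[be] (fun k => (qpow be == k)%:R).
Proof. by move=> al _; rewrite mcoeffX (inj_eq qpow_inj). Qed.

Lemma dconv_pairs (a b : nat -> K) k :
  dconv a b k
  = \sum_(x : 'I_k.+1 * 'I_k.+1 | (x.1 * x.2 == k)%N) a x.1 * b x.2.
Proof.
rewrite /dconv big_mkord; under eq_bigr do rewrite big_mkord.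
by rewrite pair_bigA [RHS]big_mkcond.
Qed.

(** By unique factorization, splittings of the exponent [al] correspond to factorizations of
    [qpow al] with both factors in [S]; all other factorizations contribute 0 by the support
    conditions. *)
Lemma agreeM d p a p' a' : supported a -> supported a' ->
  agree d p a -> agree d p' a' -> agree d (p * p') (dconv a a').
Proof.
move=> sa sa' h h' al ald; rewrite mcoeffM dconv_pairs.
set N := mdeg al; set k := qpow al.
pose A := [set x : 'X_{1..m < N.+1} * 'X_{1..m < N.+1} | al == (x.1 + x.2)%MM].
pose phi (x : 'X_{1..m < N.+1} * 'X_{1..m < N.+1}) : 'I_k.+1 * 'I_k.+1 :=
  (inord (qpow x.1), inord (qpow x.2)).
have phiE x : x \in A -> (qpow x.1 * qpow x.2 = k)%N
    /\ (qpow x.1 < k.+1)%N /\ (qpow x.2 < k.+1)%N.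
  rewrite inE => /eqP alE; have kE : (qpow x.1 * qpow x.2 = k)%N.
    by rewrite -qpowD -alE.
  by split; rewrite // !ltnS -kE leq_pmulr ?leq_pmull.
have phi_inj : {in A &, injective phi}.
  move=> x y /phiE[_ [x1 x2]] /phiE[_ [y1 y2]] [].
  move=> /(congr1 (@nat_of_ord _)) + /(congr1 (@nat_of_ord _)).
  rewrite !inordK // => /qpow_inj e1 /qpow_inj e2.
  by case: x y e1 e2 {x1 x2 y1 y2} => [x1 x2] [y1 y2] /= /val_inj-> /val_inj->.
have imA (x : 'I_k.+1 * 'I_k.+1) : (x.1 * x.2 == k)%N ->
    x \notin phi @: A -> a x.1 * a' x.2 = 0.
  move=> /eqP xk; apply: contraNeq.
  have [Sx1|/sa ->] := boolp.pselect (S x.1); last by rewrite mul0r eqxx.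
  have [Sx2|/sa' ->] := boolp.pselect (S x.2); last by rewrite mulr0 eqxx.
  move=> _; have [be [ga [x1E x2E]]] := qpow_dvd Sx1 Sx2 xk.
  have alE : al = (be + ga)%MM by apply: qpow_inj; rewrite qpowD -x1E -x2E xk.
  have beN : (mdeg be < N.+1)%N by rewrite ltnS /N alE mdegD leq_addr.
  have gaN : (mdeg ga < N.+1)%N by rewrite ltnS /N alE mdegD leq_addl.
  apply/imsetP; exists (BMultinom beN, BMultinom gaN); first by rewrite inE alE.
  rewrite /phi /= -x1E -x2E; case: x {xk Sx1 Sx2 x1E x2E} => x1 x2 /=.
  by rewrite !inord_val.
rewrite [RHS](bigID (mem (phi @: A))) /= [X in _ + X]big1 ?addr0; last first.
  by move=> x /andP[xk xA]; apply: imA.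
rewrite (eq_bigl (mem (phi @: A))) => [|x]; last first.
  rewrite andb_idl // => /imsetP[y yA ->] /=.
  by have [yk [y1 y2]] := phiE y yA; rewrite !inordK // yk.
rewrite big_imset //=; apply: eq_big => [x|x /eqP alE]; first by rewrite inE.
have [_ [x1 x2]] : (qpow x.1 * qpow x.2 = k)%N
    /\ (qpow x.1 < k.+1)%N /\ (qpow x.2 < k.+1)%N by apply: phiE; rewrite inE alE.
rewrite !inordK // h ?h' // (leq_trans _ ald) // alE mdegD ?leq_addr ?leq_addl //.
Qed.

Definition box_mnm d (f : {ffun 'I_m -> 'I_d.+1}) : 'X_{1..m} :=
  [multinom (f i : nat) | i < m].

(** Truncating each exponent separately, rather than the total degree, makes the norm estimate below
    factor into geometric sums. *)
Definition box_lift (a : nat -> K) (d : nat) : {mpoly K[m]} :=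
  \sum_(f : {ffun 'I_m -> 'I_d.+1}) a (qpow (box_mnm f)) *: 'X_[box_mnm f].

Lemma agree_box_lift d a : agree d (box_lift a d) a.
Proof.
move=> al ald; pose f0 := [ffun i => inord (al i) : 'I_d.+1].
have f0E : box_mnm f0 = al.
  apply/mnmP => i; rewrite mnmE ffunE inordK // ltnS (leq_trans _ ald) //.
  by rewrite mdegE (bigD1 i) //= leq_addr.
rewrite raddf_sum (bigD1 f0) //= mcoeffZ mcoeffX f0E eqxx mulr1 big1 ?addr0 //.
move=> f ff0; rewrite mcoeffZ mcoeffX; case: eqP => [fal|]; last by rewrite mulr0.
case/eqP: ff0; apply/ffunP => i; apply: val_inj => /=.
by rewrite ffunE -fal mnmE inord_val.
Qed.

(** Since [|a k| <= C * k] and [qpow] is a product over the variables, each variable contributes at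
    most the sum of the powers of 1/2, which is below 2. The bound does not depend on [d]. *)
Lemma mnorm_box_lift (Q : nat) (rho C : K) a d :
    (forall i, q i <= Q)%N -> 0 <= rho -> Q%:R * rho <= 2^-1 ->
    poly_growth 0 C a ->
  mnorm rho (box_lift a d) <= C * 2 ^+ m.
Proof.
move=> qQ rho0 Qrho ha; have C0 := poly_growth_ge0 ha.
apply: le_trans (mnorm_sum _ _ _ rho0) _.
apply: (@le_trans _ _ (\sum_(f : {ffun 'I_m -> 'I_d.+1})
    C * \prod_i (2^-1) ^+ (f i : nat))).
  apply: ler_sum => f _; rewrite mnormZX.
  apply: (@le_trans _ _ (C * (qpow (box_mnm f))%:R * rho ^+ mdeg (box_mnm f))).
    by rewrite ler_wpM2r ?exprn_ge0 // -[X in C * X]expr1 ha.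
  rewrite -mulrA ler_wpM2l // mdegE -prodrXr /qpow natr_prod -big_split /=.
  apply: ler_prod => i _; rewrite natrX -exprMn mnmE.
  rewrite exprn_ge0 ?mulr_ge0 //= lerXn2r ?nnegrE ?mulr_ge0 ?invr_ge0 //.
  by rewrite (le_trans _ Qrho) // ler_wpM2r // ler_nat.
rewrite -mulr_sumr ler_wpM2l //.
rewrite -(bigA_distr_bigA (fun (i : 'I_m) (k : 'I_d.+1) => 2^-1 ^+ k)) /=.
rewrite -[X in _ <= _ ^+ X]card_ord -prodr_const; apply: ler_prod => _ _.
rewrite sumr_ge0 /= => [|k _]; last by rewrite exprn_ge0 // invr_ge0.
rewrite -(big_mkord xpredT (fun k => 2^-1 ^+ k : K)).
suff: \sum_(0 <= k < d.+1) 2^-1 ^+ k <= 2 - 2^-1 ^+ d :> K.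
  by move=> h; rewrite (le_trans h) // gerBl exprn_ge0 // invr_ge0.
elim: d => [|d ih]; first by rewrite big_nat1 !expr0 (_ : 2 - 1 = 1) //; ring.
rewrite big_nat_recr //=; apply: le_trans (lerD ih (lexx _)) _.
rewrite -addrA lerD2l exprS.
suff -> : - 2^-1 ^+ d + 2^-1 * 2^-1 ^+ d = - (2^-1 * 2^-1 ^+ d) :> K by [].
by field.
Qed.

Definition delta (k0 k : nat) : K := (k0 == k)%:R.

Lemma supported_delta k0 : S k0 -> supported (delta k0).
Proof. by rewrite /delta => Sk k; case: eqP => // <-. Qed.

Lemma supportedD a b : supported a -> supported b ->
  supported (fun k => a k + b k).
Proof. by move=> sa sb k Sk; rewrite sa // sb // addr0. Qed.

Lemma supportedZ c a : supported a -> supported (fun k => c * a k).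
Proof. by move=> sa k Sk; rewrite sa // mulr0. Qed.

Lemma supported_sum (I : Type) (s : seq I) a :
    (forall i, supported (a i)) -> supported (fun k => \sum_(i <- s) a i k).
Proof. by move=> sa k Sk; rewrite big1 // => i _; apply: sa. Qed.

Lemma supported_conv a b : (forall d e, S d -> S e -> S (d * e)%N) ->
  supported a -> supported b -> supported (dconv a b).
Proof.
move=> S_mul sa sb k Sk; rewrite /dconv big1 // => d _; rewrite big1 // => e _.
rewrite /conv_term; case: eqP => // kE.
have [Sd|/sa ->] := boolp.pselect (S d); last by rewrite mul0r.
have [Se|/sb ->] := boolp.pselect (S e); last by rewrite mulr0.
by case: Sk; rewrite -kE; apply: S_mul.
Qed.

End BohrLift.

(** * From values at integers to identities between Dirichlet coefficients *)

Section DirichletEvaluation.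
Local Open Scope ring_scope.
Variable K : numFieldType.
Hypothesis archK : forall x : K, 0 <= x -> exists k : nat, x <= k%:R.

(** The growth exponent, constant and threshold are existential because convolution enlarges them;
    values at large integers suffice for uniqueness. *)
Definition sums_to (a : nat -> K) (f : nat -> K) :=
  exists p C s0, poly_growth p C a /\
    forall s, (s0 <= s)%N -> tends (dsum a s) (f s).

Lemma sums_toD a f b g : sums_to a f -> sums_to b g ->
  sums_to (fun k => a k + b k) (fun s => f s + g s).
Proof.
move=> [p [C [s0 [ha hf]]]] [p' [C' [s1 [hb hg]]]].
exists (maxn p p'), (C + C'), (maxn s0 s1); split; first exact: poly_growthD.
move=> s; rewrite geq_max => /andP[/hf {}hf /hg {}hg].
apply: tends_eventually (tendsD hf hg) (_ : forall N, (0 <= N)%N -> _) => N _.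
by rewrite /dsum -big_split; apply: eq_bigr => k _; rewrite mulrDl.
Qed.

Lemma sums_toZ c a f : sums_to a f ->
  sums_to (fun k => c * a k) (fun s => c * f s).
Proof.
move=> [p [C [s0 [ha hf]]]]; exists p, (`|c| * C), s0; split.
  by move=> k; rewrite normrM -mulrA ler_wpM2l.
move=> s /hf {}hf.
apply: tends_eventually (tendsM (tends_cst c) hf) (_ : forall N, (0 <= N)%N -> _).
by move=> N _; rewrite /dsum mulr_sumr; apply: eq_bigr => k _; rewrite mulrA.
Qed.

Lemma sums_to_sum (I : Type) (s : seq I) (a f : I -> nat -> K) :
    (forall i, sums_to (a i) (f i)) ->
  sums_to (fun k => \sum_(i <- s) a i k) (fun t => \sum_(i <- s) f i t).
Proof.
move=> h; elim: s => [|i s ih].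
  exists 0%N, 0, 0%N; split=> [k|t _]; first by rewrite big_nil normr0 mul0r.
  rewrite big_nil; apply: tends_eventually (tends_cst 0) (_ : forall N, (0 <= N)%N -> _).
  by move=> N _; rewrite /dsum big1 // => k _; rewrite big_nil mul0r.
have [p [C [s0 [ha hf]]]] := sums_toD (h i) ih.
exists p, C, s0; split=> [k|t /hf {}hf]; first by rewrite big_cons; apply: ha.
rewrite big_cons; apply: tends_eventually hf (_ : forall N, (0 <= N)%N -> _) => N _.
by apply: eq_bigr => k _; rewrite big_cons.
Qed.

Lemma sums_to_delta k0 : (0 < k0)%N ->
  sums_to (delta K k0) (fun s => (k0%:R ^+ s)^-1).
Proof.
move=> k00; exists 0%N, 1, 0%N; split.
  move=> k; rewrite mul1r /delta expr1; case: eqP => [<-|_]; last by rewrite normr0.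
  by rewrite normr1 (ler_nat _ 1).
move=> s _; apply: tends_eventually (tends_cst _) (_ : forall N, (k0 <= N)%N -> _).
move=> N k0N; rewrite /dsum (eq_bigr (fun k => if k == k0 then (k%:R ^+ s)^-1 else 0)).
  by rewrite -big_mkcond big_nat1_eq /= ltnS k0N.
by move=> k _; rewrite /delta eq_sym; case: eqP; rewrite ?mul1r ?mul0r.
Qed.

Lemma sums_to_conv a f b g : sums_to a f -> sums_to b g ->
  sums_to (dconv a b) (fun s => f s * g s).
Proof.
move=> [p [C [s0 [ha hf]]]] [p' [C' [s1 [hb hg]]]].
have {}ha : poly_growth (maxn p p') C a.
  by apply: poly_growth_weaken ha => //; apply: leq_maxl.
have {}hb : poly_growth (maxn p p') C' b.
  by apply: poly_growth_weaken hb => //; apply: leq_maxr.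
exists (maxn p p').+2, (4 * C * C'), (maxn (maxn p p' + 4) (maxn s0 s1)); split.
  exact: poly_growth_conv.
move=> s; rewrite !geq_max => /andP[ps /andP[/hf {}hf /hg {}hg]].
by apply: (tends_dsum_conv archK ha hb) => //; lia.
Qed.

Lemma sums_to0 a f s0 : sums_to a f -> (forall s, (s0 <= s)%N -> f s = 0) ->
  forall k, a k = 0.
Proof.
move=> [p [C [s1 [ha hf]]]] f0; apply: (dirichlet_unique archK (s0 := maxn s0 s1) ha).
by move=> s; rewrite geq_max => /andP[/f0 <- /hf].
Qed.

Import mpoly.
Variables (n Q : nat) (q : 'I_(n + n) -> nat) (S : nat -> Prop).
Hypothesis q_gt0 : forall i, (0 < q i)%N.
Hypothesis q_le : forall i, (q i <= Q)%N.
Hypothesis Q_gt0 : (0 < Q)%N.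
Hypothesis S_1 : S 1%N.
Hypothesis S_q : forall i, S (q i).
Hypothesis S_mul : forall d e, S d -> S e -> S (d * e)%N.
Hypothesis exponent_unique : forall f g : 'I_(n + n) -> nat,
  (\prod_i q i ^ f i = \prod_i q i ^ g i)%N -> f =1 g.
Hypothesis divisor_exponent : forall d e (f : 'I_(n + n) -> nat), S d -> S e ->
  (d * e = \prod_i q i ^ f i)%N -> exists g, d = (\prod_i q i ^ g i)%N.

(** Chosen so that the largest radius in [ball_no_retraction], four times this one, equals
    [1 / (2 * Q)], the limit allowed by [mnorm_box_lift]. *)
Definition bohr_radius : K := (8 * Q%:R)^-1.

Lemma not_sums_to1 (x b xv bv : 'I_n -> nat -> K) C :
    (forall i, poly_growth 0 C (x i)) -> (forall i, poly_growth 0 C (b i)) ->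
    (forall i, supported S (x i)) -> (forall i, supported S (b i)) ->
    (forall i s, (0 < s)%N -> tends (dsum (x i) s) (xv i s)) ->
    (forall i s, (0 < s)%N -> tends (dsum (b i) s) (bv i s)) ->
  ~ (forall s, (0 < s)%N ->
     \sum_(i < n) bv i s * (((q (zi i))%:R ^+ s)^-1 + xv i s *
       (bohr_radius ^+ 2 - \sum_(j < n) ((q (zi j) * q (wi j))%:R ^+ s)^-1)) = 1).
Proof.
move=> gx gb sx sb hx hb eq1.
(* The sequences [gc], [hc i] and [Fc] are the coefficients of [g], of [h_i = z_i + x_i g] and of
   [sum b_i h_i - 1]. *)
pose gc k := bohr_radius ^+ 2 * delta K 1 k
  + (-1) * \sum_(j < n) delta K (q (zi j) * q (wi j)) k.
pose hc i k := delta K (q (zi i)) k + dconv (x i) gc k.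
pose Fc k := \sum_(i < n) dconv (b i) (hc i) k + (-1) * delta K 1 k.
have xs i : sums_to (x i) (xv i).
  by exists 0%N, C, 1%N; split=> [|s]; [apply: gx|apply: hx].
have bs i : sums_to (b i) (bv i).
  by exists 0%N, C, 1%N; split=> [|s]; [apply: gb|apply: hb].
have Fc0 : forall k, Fc k = 0.
  have Fs := sums_toD (sums_to_sum (index_enum 'I_n) (fun i => sums_to_conv (bs i)
    (sums_toD (sums_to_delta (q_gt0 (zi i))) (sums_to_conv (xs i)
      (sums_toD (sums_toZ (bohr_radius ^+ 2) (sums_to_delta (ltn0Sn 0)))
        (sums_toZ (-1) (sums_to_sum (index_enum 'I_n) (fun j => sums_to_delta
          (_ : 0 < q (zi j) * q (wi j))%N))))))))
    (sums_toZ (-1) (sums_to_delta (ltn0Sn 0))).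
  apply: (sums_to0 (s0 := 1%N) (Fs _)) => [j|s s0]; first by rewrite muln_gt0 !q_gt0.
  rewrite /= !expr1n !invr1 !mulr1 mulN1r.
  by rewrite eq1 // subrr.
have sg : supported S gc.
  apply: supportedD; apply: supportedZ; first exact: supported_delta.
  by apply: supported_sum => j; apply: supported_delta; apply: S_mul.
have sh i : supported S (hc i).
  by apply: supportedD; [apply: supported_delta|apply: supported_conv].
pose X d i := box_lift q (x i) d; pose B d i := box_lift q (b i) d.
have qpow_inj : injective (qpow q).
  by move=> al be /exponent_unique albe; apply/mnmP.
have qpow_dvd d e al : S d -> S e -> (d * e)%N = qpow q al ->
    exists be ga, d = qpow q be /\ e = qpow q ga.
  have lift_exp (g : 'I_(n + n) -> nat) :
      (\prod_i q i ^ g i)%N = qpow q [multinom g i | i < n + n].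
    by apply: eq_bigr => i _; rewrite mnmE.
  move=> Sd Se deal; have [g ->] := divisor_exponent Sd Se deal.
  rewrite mulnC in deal; have [h ->] := divisor_exponent Se Sd deal.
  by exists [multinom g i | i < n + n], [multinom h i | i < n + n].
have qpow_gt0 al : (0 < qpow q al)%N by apply: prodn_gt0 => i; rewrite expn_gt0 q_gt0.
have ag_delta d al k0 : qpow q al = k0 -> agree q d 'X_[al] (delta K k0).
  by move=> <-; apply: agreeX.
(* The polynomial agrees with [Fc], which is 0, up to degree [d]: truncating the lifts only spoils
   higher degrees. *)
have XB d : vanishes_below d.+1 (\sum_(i < n) B d i *
    ('X_(zi i) + X d i * ball_eq n (bohr_radius ^+ 2)) - 1).
  have ag : agree q d (ball_eq n (bohr_radius ^+ 2)) gc.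
    have -> : ball_eq n (bohr_radius ^+ 2) = bohr_radius ^+ 2 *: 'X_[0]
        + (-1) *: \sum_(j < n) 'X_[U_(zi j) + U_(wi j)].
      rewrite mpolyX0 alg_mpolyC scaleN1r; congr (_ - _).
      by apply: eq_bigr => j _; rewrite mpolyXD.
    apply: agreeD; apply: agreeZ; first by apply: ag_delta; apply: qpow0.
    by apply: agree_sum => j; apply: ag_delta; rewrite qpowD !qpowU.
  suff agF : agree q d (\sum_(i < n) B d i *
      ('X_(zi i) + X d i * ball_eq n (bohr_radius ^+ 2)) - 1) Fc.
    by move=> al ald; rewrite agF // Fc0.
  rewrite -scaleN1r -mpolyX0; apply: agreeD; last first.
    by apply: agreeZ; apply: ag_delta; apply: qpow0.
  apply: agree_sum => i; apply: (agreeM qpow_inj qpow_gt0 qpow_dvd (S:=S)) => //.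
    exact: agree_box_lift.
  apply: agreeD; first by apply: ag_delta; apply: qpowU.
  by apply: (agreeM qpow_inj qpow_gt0 qpow_dvd (S:=S)) => //; apply: agree_box_lift.
have r0 : 0 < bohr_radius by rewrite invr_gt0 mulr_gt0 ?ltr0n.
have Qr : Q%:R * (2 * (2 * bohr_radius)) <= 2^-1.
  suff -> : Q%:R * (2 * (2 * bohr_radius)) = 2^-1 by [].
  by rewrite /bohr_radius; field; rewrite pnatr_eq0 -lt0n.
have bd (a : 'I_n -> nat -> K) i : (forall i, poly_growth 0 C (a i)) ->
    norm_bounded (2 * (2 * bohr_radius)) (fun d => box_lift q (a i) d).
  move=> ga; exists (C * 2 ^+ (n + n)) => d; apply: mnorm_box_lift (ga i) => //.
  by rewrite !mulr_ge0 // ltW.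
have [M hM] := ball_no_retraction r0 (fun i => bd x i gx) (fun i => bd b i gb) XB.
have n0 : 0 < n`!%:R :> K by rewrite ltr0n fact_gt0.
(* At [d = t] the bound would give [2 ^ t <= M * n! <= t]. *)
have [|t ht] := @archK (M * n`!%:R).
  by rewrite mulr_ge0 // (le_trans _ (hM 0%N)) // mulr_ge0 ?invr_ge0.
have := hM t; rewrite ler_pdivrMr // => /le_trans /(_ ht).
by rewrite -natrX ler_nat leqNgt ltn_expl.
Qed.

End DirichletEvaluation.

From mathcomp Require Import finmap all_classical all_reals all_analysis.
Import numFieldNormedType.Exports.
Local Open Scope classical_set_scope.

(** * Unique factorization in the semigroup *)

Section Exponents.
Variables (S : set nat) (q : nat -> nat).
Hypothesis S_1 : S 1%N.
Hypothesis S_mul : forall m n : nat, S m -> S n -> S (m * n)%N.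
Hypothesis q_S : forall k : nat, S (q k).
Hypothesis q_fact : forall n : nat, S n ->
  exists! alpha : nat -> nat,
    compactly_supported alpha /\
    n = \big[muln/1%N]_(k \in [set: nat]) (q k ^ alpha k)%N.

Lemma fsbig_exponents (alpha : nat -> nat) N :
    (forall k, (N <= k)%N -> alpha k = 0%N) ->
  (\big[muln/1]_(k \in [set: nat]) (q k ^ alpha k) = \prod_(k < N) q k ^ alpha k)%N.
Proof.
move=> aN; rewrite (fsbig_ord _ _ (fun k => q k ^ alpha k)%N).
apply/esym/fsbig_widen => // k [_ /=]; rewrite /mkset => /negP.
by rewrite -leqNgt => /aN ->.
Qed.

Lemma compactly_supportedP (alpha : nat -> nat) :
  compactly_supported alpha <-> exists N, forall k, (N <= k)%N -> alpha k = 0%N.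
Proof.
split=> [fin|[N aN]]; last first.
  apply: sub_finite_set (finite_II N) => k /= /eqP ak.
  by rewrite ltnNge; apply/negP => /aN.
exists (\max_(k <- fset_set [set k | alpha k != 0%N]) k.+1) => k Nk.
apply/eqP; apply: contraTT Nk => ak; rewrite -ltnNge.
apply: (@leq_bigmax_seq _ _ xpredT (fun j => j.+1) k) => //.
by rewrite in_fset_set // inE.
Qed.

Lemma exponents_unique N M (alpha beta : nat -> nat) :
    (forall k, (N <= k)%N -> alpha k = 0%N) ->
    (forall k, (M <= k)%N -> beta k = 0%N) ->
    (\prod_(k < N) q k ^ alpha k = \prod_(k < M) q k ^ beta k)%N ->
  alpha = beta.
Proof.
move=> aN bM ab.
have Sprod K (ga : nat -> nat) : S (\prod_(k < K) q k ^ ga k)%N.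
  elim/big_ind: _ => // k _.
  by elim: (ga k) => [|j ih] //; rewrite expnS; apply: S_mul.
have [ga [_ ga_uniq]] := q_fact (Sprod N alpha).
rewrite -(ga_uniq alpha); last first.
  by split; [apply/compactly_supportedP; exists N|rewrite (fsbig_exponents aN)].
apply: ga_uniq; split; first by apply/compactly_supportedP; exists M.
by rewrite (fsbig_exponents bM).
Qed.

Definition extend_exponent m (f : 'I_m -> nat) (k : nat) : nat :=
  oapp f 0%N (insub k).

Lemma extend_exponentE m (f : 'I_m -> nat) (i : 'I_m) : extend_exponent f i = f i.
Proof. by rewrite /extend_exponent valK. Qed.

Lemma extend_exponent0 m (f : 'I_m -> nat) k : (m <= k)%N -> extend_exponent f k = 0%N.
Proof. by move=> mk; rewrite /extend_exponent insubF // ltnNge mk. Qed.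

Lemma exponent_unique m (f g : 'I_m -> nat) :
  (\prod_(i < m) q i ^ f i = \prod_(i < m) q i ^ g i)%N -> f =1 g.
Proof.
move=> fg i; rewrite -(extend_exponentE f) -(extend_exponentE g).
suff -> : extend_exponent f = extend_exponent g by [].
apply: (exponents_unique (extend_exponent0 f) (extend_exponent0 g)).
under eq_bigr do rewrite extend_exponentE.
by under [RHS]eq_bigr do rewrite extend_exponentE.
Qed.

(** Both factors lie in [S] and so have exponents of their own. By uniqueness these add up to [f],
    which is 0 from index [m] on; being nonnegative, they vanish there too. *)
Lemma divisor_exponent m d e (f : 'I_m -> nat) : S d -> S e ->
  (d * e = \prod_(i < m) q i ^ f i)%N ->
  exists g : 'I_m -> nat, d = (\prod_(i < m) q i ^ g i)%N.
Proof.
move=> Sd Se de.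
have [al [[/compactly_supportedP[N aN] dE] _]] := q_fact Sd.
have [be [[/compactly_supportedP[M bM] eE] _]] := q_fact Se.
pose P := maxn N M.
have aP k : (P <= k)%N -> al k = 0%N by rewrite geq_max => /andP[/aN].
have bP k : (P <= k)%N -> be k = 0%N by rewrite geq_max => /andP[_ /bM].
have abf : (fun k => al k + be k)%N = extend_exponent f.
  apply: (@exponents_unique P m) => [k Pk||].
  - by rewrite aP ?bP.
  - exact: extend_exponent0.
  transitivity (d * e)%N.
    rewrite dE eE (fsbig_exponents aP) (fsbig_exponents bP) -big_split /=.
    by apply: eq_bigr => k _; rewrite expnD.
  by rewrite de; under [RHS]eq_bigr do rewrite extend_exponentE.
exists (fun i => al i); rewrite dE (@fsbig_exponents _ m) // => k mk.
apply/eqP; have := congr1 (@^~ k) abf; rewrite /= extend_exponent0 // => /eqP.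
by rewrite addn_eq0 => /andP[].
Qed.

End Exponents.

(** * Dirichlet series on the half-plane *)

Section HalfPlane.
Variable R : realType.
Local Open Scope ring_scope.
Local Notation C := R[i].

(** In the order of [R[i]], [0 <= x] forces [x] to be real. *)
Lemma archimedean_complex (x : C) : 0 <= x -> exists k : nat, x <= k%:R.
Proof.
move=> x0; have xE : x = real_complex R (complex.Re x).
  by move: x0; case: x => a b; rewrite lecE /= => /andP[/eqP-> _].
exists (Num.bound (complex.Re x)); rewrite xE -(rmorph_nat (real_complex R)) lecR ltW //.
by rewrite archi_boundP //; move: x0; rewrite lecE => /andP[].
Qed.

Lemma normcE (x : C) : `|x| = real_complex R (Normc.normc x).
Proof. by case: x. Qed.

Lemma cexpD (x y : C) : cexp (x + y) = cexp x * cexp y.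
Proof.
case: x => a b; case: y => c d; rewrite /cexp /= expRD cosD sinD.
by apply/eqP; rewrite eq_complex /=; apply/andP; split; apply/eqP; ring.
Qed.

Lemma npowNM j k (s : C) : (0 < j)%N -> (0 < k)%N ->
  npowN (j * k) s = npowN j s * npowN k s.
Proof.
move=> j0 k0; rewrite /npowN natrM lnM ?posrE ?ltr0n //.
by rewrite rmorphD mulrDr cexpD.
Qed.

Lemma npowN1 (s : C) : npowN 1 s = 1.
Proof.
rewrite /npowN ln1 mulr0 /cexp /= expR0 cos0 sin0 mulr1 mulr0.
by [].
Qed.

Lemma normc_cexp (z : C) : Normc.normc (cexp z) = expR (complex.Re z).
Proof.
by rewrite /cexp /= !exprMn -mulrDr cos2Dsin2 mulr1 sqrtr_sqr ger0_norm ?expR_ge0.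
Qed.

Lemma normc_npowN k (s : right_half_plane R) : (0 < k)%N ->
  Normc.normc (npowN k (val s)) <= 1.
Proof.
rewrite normc_cexp; case: s => -[x y] /= x0 k0; rewrite mulr0 subr0.
by rewrite -[leRHS]expR0 ler_expR mulNr oppr_le0 mulr_ge0 ?(ltW x0) // ln_ge0 ?ler1n.
Qed.

Lemma natural_point_subproof (s : nat) : 0 < complex.Re (real_complex R s.+1%:R).
Proof. by rewrite /= ltr0n. Qed.

Definition natural_point (s : nat) : right_half_plane R :=
  exist _ (real_complex R s.+1%:R) (natural_point_subproof s).

Lemma npowN_natural k s : (0 < k)%N ->
  npowN k (val (natural_point s)) = (k%:R ^+ s.+1)^-1.
Proof.
move=> k0; rewrite /npowN -rmorphN -rmorphM mulNr /cexp /= cos0 sin0 mulr0 mulr1.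
rewrite expRN expRM_natl lnK ?posrE ?ltr0n //.
by rewrite -[Complex _ _]/(real_complex R _) fmorphV rmorphXn rmorph_nat.
Qed.

End HalfPlane.

(** * Dirichlet polynomials and coefficient bounds in [HinfS] *)

Section HinfSMembers.
Variable R : realType.
Local Open Scope ring_scope.
Local Notation C := R[i].

Lemma HinfS_polynomial (S : set nat) (l : seq (C * nat)) :
    (forall n, S n -> (0 < n)%N) -> (forall x, x \in l -> S x.2) ->
  HinfS R S (fun s => \sum_(x <- l) x.1 * npowN x.2 (val s)).
Proof.
move=> S_pos lS.
(* The list may repeat an index, so equal indices are merged. *)
pose a n : C := \sum_(x <- l | n == x.2) x.1.
have fa : has_dirichlet_series
    (fun s : right_half_plane R => \sum_(x <- l) x.1 * npowN x.2 (val s)) a.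
  move=> s; apply/(@cvgrPdist_le C C^o) => e e0.
  exists (\max_(x <- l) x.2)%N => // N /= lN.
  suff -> : dirichlet_partial_sum a (val s) N = \sum_(x <- l) x.1 * npowN x.2 (val s).
    by rewrite subrr normr0 ltW.
  rewrite /dirichlet_partial_sum; under eq_bigr => n _.
    rewrite mulr_suml big_mkcond /=; over.
  rewrite exchange_big /= big_seq [RHS]big_seq; apply: eq_bigr => x xl.
  rewrite -big_mkcond /= (big_nat1_eq _ (fun n => x.1 * npowN n (val s))).
  rewrite (S_pos _ (lS _ xl)) ifT //= ltnS (leq_trans _ lN) //.
  by apply: (@leq_bigmax_seq _ _ xpredT (fun x => x.2) x).
split; last first.
  exists a => // n n0 Sn; rewrite /a big_seq_cond big1 // => x /andP[xl /eqP nx].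
  by case: Sn; rewrite nx; apply: lS.
split; first by exists a.
apply: (@le_lt_trans _ _ (\sum_(x <- l) Normc.normc x.1)%:E); last by rewrite ltry.
apply: ge_ereal_sup => _ [s _ <-]; rewrite lee_fin.
rewrite -lecR rmorph_sum /= -normcE (le_trans (ler_norm_sum _ _ _)) //.
rewrite big_seq [leRHS]big_seq; apply: ler_sum => x xl.
rewrite -[leRHS]normcE normrM ler_piMr // normcE -[leRHS](rmorph1 (real_complex R)).
by rewrite lecR normc_npowN //; apply: S_pos (lS _ xl).
Qed.

Lemma HinfS_coefficients (S : set nat) (f : right_half_plane R -> C) :
    HinfS R S f -> exists a : nat -> C, [/\ supported S a,
      exists M, poly_growth 0 M a &
      forall s, (0 < s)%N -> tends (dsum a s) (f (natural_point R s.-1))].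
Proof.
(* The coefficient at 0 is arbitrary in [b]; it is reset to 0 for [poly_growth]. Growth then follows
   from convergence at [s = 1], which is [natural_point R 0]. *)
move=> [_ [b fb bS]]; pose a k := if k == 0%N then 0 else b k.
have lim s : (0 < s)%N -> tends (dsum a s) (f (natural_point R s.-1)).
  move=> s0 e e0.
  have /(@cvgrPdist_le C C^o)/(_ e e0)[N0 _ h] := fb (natural_point R s.-1).
  exists N0 => N /h /=; rewrite distrC; congr (`|_ - _| <= _).
  rewrite /dsum big_ltn //= /a eqxx mul0r add0r.
  apply: eq_big_nat => k /andP[k0 _]; rewrite npowN_natural // prednK //.
  by rewrite gtn_eqF.
exists a; split=> // [k Sk|].
  by rewrite /a; case: eqP => // /eqP; rewrite -lt0n => k0; apply: bS.
by apply: poly_growth_dsum (lim 1%N isT).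
Qed.

End HinfSMembers.

(** * An irreducible unimodular tuple for every length *)

Section NotStable.
Variables (R : realType) (S : set nat) (q : nat -> nat).
Hypothesis S_pos : forall n : nat, S n -> (0 < n)%N.
Hypothesis S_1 : S 1%N.
Hypothesis S_mul : forall m n : nat, S m -> S n -> S (m * n)%N.
Hypothesis q_S : forall k : nat, S (q k).
Hypothesis q_lt : forall j k : nat, (j < k)%N -> (q j < q k)%N.
Hypothesis q_fact : forall n : nat, S n ->
  exists! alpha : nat -> nat,
    compactly_supported alpha /\
    n = \big[muln/1%N]_(k \in [set: nat]) (q k ^ alpha k)%N.
Local Open Scope ring_scope.
Local Notation C := R[i].
Local Notation T := (right_half_plane R -> C).

Lemma not_stable_range n : ~ stable_range (HinfS R S) n.
Proof.
move=> [_ red]; pose qq (i : 'I_(n + n)) := q i; pose Q := q (n + n)%N.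
have q0 k : (0 < q k)%N by apply: S_pos.
pose c : C := bohr_radius C Q ^+ 2.
have c0 : c != 0.
  by rewrite expf_neq0 // invr_neq0 // mulf_neq0 ?pnatr_eq0 // -lt0n q0.
pose z (j : 'I_n) : T := fun s => npowN (qq (zi j)) (val s).
pose w (j : 'I_n) : T := fun s => npowN (qq (wi j)) (val s).
pose g : T := fun s => c - \sum_(j < n) npowN (qq (zi j) * qq (wi j)) (val s).
pose extend (u : 'I_n -> T) v (i : 'I_n.+1) :=
  if unlift ord_max i is Some j then u j else v.
have extendw u v j : extend u v (widen_ord (leqnSn n) j) = u j.
  rewrite /extend (_ : widen_ord _ j = lift ord_max j) ?liftK //.
  by apply: val_inj; rewrite /= /bump leqNgt ltn_ord.
have extend_max u v : extend u v ord_max = v by rewrite /extend unlift_none.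
have monoS d k : S k -> HinfS R S (fun s => d * npowN k (val s)).
  move=> Sk; have := @HinfS_polynomial R S [:: (d, k)] S_pos.
  rewrite (_ : (fun s => _) = fun s => d * npowN k (val s)).
    by apply=> x; rewrite inE => /eqP->.
  by apply/funext => s; rewrite big_seq1.
have cS d : HinfS R S (fun=> d).
  rewrite (_ : (fun=> d) = fun s => d * npowN 1 (val s)); first exact: monoS.
  by apply/funext => s; rewrite npowN1 mulr1.
have zS j : HinfS R S (z j).
  rewrite (_ : z j = fun s => 1 * z j s); first exact: (monoS 1 _ (q_S _)).
  by apply/funext => s; rewrite mul1r.
have gS : HinfS R S g.
  have := @HinfS_polynomial R S
    ((c, 1%N) :: [seq (-1, (qq (zi j) * qq (wi j))%N) | j <- index_enum 'I_n]) S_pos.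
  rewrite (_ : (fun s => _) = g).
    apply=> x; rewrite inE => /orP[/eqP->|/mapP[j _ ->]]; first exact: S_1.
    by apply: S_mul; apply: q_S.
  apply/funext => s; rewrite big_cons big_map npowN1 mulr1 /g -sumrN; congr (_ + _).
  by apply: eq_bigr => j _; rewrite mulN1r.
have uni : unimodular (HinfS R S) (extend z g).
  split; first by move=> i; rewrite /extend; case: unlift.
  (* These coefficients come from [sum_j w_j z_j + g = c]. *)
  exists (extend (fun j s => c^-1 * w j s) (fun=> c^-1)); split.
    move=> i; rewrite /extend; case: unlift => [j|]; last exact: cS.
    exact: (monoS _ _ (q_S _)).
  apply/funext => s; rewrite fct_sumE big_ord_recr /= !extend_max.
  under eq_bigr => j _ do rewrite !extendw.
  transitivity (\sum_(j < n) c^-1 * (w j s * z j s) + c^-1 * g s).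
    by congr (_ + _); apply: eq_bigr => j _; rewrite mulrA.
  transitivity (c^-1 * c); last exact: mulVf.
  rewrite -mulr_sumr -mulrDr /g addrC -addrA [X in _ * (_ + X)](_ : _ = 0) ?addr0 //.
  apply/eqP; rewrite addrC subr_eq0; apply/eqP; apply: eq_bigr => j _.
  by rewrite npowNM ?q0 // mulrC.
have [x [xS [_ [b [bS eq1]]]]] := red _ uni.
have [xa xaP] := fin_all_exists (fun j => HinfS_coefficients (xS j)).
have [ba baP] := fin_all_exists (fun j => HinfS_coefficients (bS j)).
have [Mx gx] := fin_all_exists (fun j => let: And3 _ h _ := xaP j in h).
have [Mb gb] := fin_all_exists (fun j => let: And3 _ h _ := baP j in h).
(* The sum of all the growth constants serves as a common one for the [x j] and the [b j]. *)
have grow (a : 'I_n -> nat -> C) M M' : (forall j, poly_growth 0 (M j) (a j)) ->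
    \sum_j M j <= M' -> forall j, poly_growth 0 M' (a j).
  move=> ga MM' j; apply: poly_growth_weaken (ga j) => //; apply: le_trans MM'.
  by rewrite (bigD1 j) //= lerDl sumr_ge0 // => i _; apply: poly_growth_ge0 (ga i).
have sum_ge0 (a : 'I_n -> nat -> C) M :
    (forall j, poly_growth 0 (M j) (a j)) -> 0 <= \sum_j M j.
  by move=> ga; apply: sumr_ge0 => i _; apply: poly_growth_ge0 (ga i).
apply: (@not_sums_to1 C (@archimedean_complex R) n Q qq S _ _ _ S_1 _ S_mul _ _ xa ba
  (fun j s => x j (natural_point R s.-1)) (fun j s => b j (natural_point R s.-1))
  (\sum_j Mx j + \sum_j Mb j)).
- by move=> i; apply: q0.
- by move=> i; apply: ltnW; apply: q_lt.
- exact: q0.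
- by move=> i; apply: q_S.
- by move=> f h; apply: (exponent_unique S_1 S_mul q_S q_fact).
- by move=> d e f; apply: (divisor_exponent S_1 S_mul q_S q_fact).
- by apply: grow gx _; rewrite lerDl (sum_ge0 _ _ gb).
- by apply: grow gb _; rewrite lerDr (sum_ge0 _ _ gx).
- by move=> i; have [] := xaP i.
- by move=> i; have [] := baP i.
- by move=> i; have [] := xaP i.
- by move=> i; have [] := baP i.
case=> // s _; have := congr1 (fun f : T => f (natural_point R s)) eq1.
have zE j : z j (natural_point R s) = ((qq (zi j))%:R ^+ s.+1)^-1.
  by apply: npowN_natural; apply: q0.
have gE : g (natural_point R s)
    = c - \sum_(j < n) ((qq (zi j) * qq (wi j))%:R ^+ s.+1)^-1.
  by congr (_ - _); apply: eq_bigr => j _; rewrite npowN_natural ?muln_gt0 ?q0.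
rewrite fct_sumE; apply: etrans; apply: eq_bigr => j _.
by rewrite extendw extend_max -[RHS]/(b j _ * (z j _ + x j _ * g _)) zE gE.
Qed.

End NotStable.

Theorem theorem6p2 (R : realType) (S : set nat)
  (S_pos : forall n : nat, S n -> (0 < n)%N)
  (S_1 : S 1%N)
  (S_mul : forall m n : nat, S m -> S n -> S (m * n)%N)
  (q : nat -> nat)
  (q_S : forall k : nat, S (q k))
  (q_lt : forall j k : nat, (j < k)%N -> (q j < q k)%N)
  (q_fact : forall n : nat, S n ->
     exists! alpha : nat -> nat,
       compactly_supported alpha /\
       n = \big[muln/1%N]_(k \in [set: nat]) (q k ^ alpha k)%N) :
  bass_stable_rank (HinfS R S) = +oo%E.
Proof.
rewrite /bass_stable_rank; case: pselect => // Hn; exfalso; case: Hn => n.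
exact: (not_stable_range S_pos S_1 S_mul q_S q_lt q_fact).
Qed.
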